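(* Let $k$ be a field, $\mathbf{c}=(c_1,\dots,c_m)$ a vector of positive integers, and $g\ge0$ an integer. Let $T=(\mathbb{G}_m)^m$ act on $\mathrm{Ter}^g_{\mathbf{c}}$ as in the context. (1) The $T$-fixed $k$-points of $\mathrm{Ter}^g_{\mathbf{c}}$ are in bijection with the tuples of numerical monoids $(M_1,\dots,M_m)$ such that $c(M_i)\le c_i$ for each $i$ and $\sum_i g(M_i)=g$. (2) Each orbit-closure of $T$'s action contains at least one $T$-invariant point. (3) There is a $k$-point of $\mathcal{Z}_{(k_d)}$ if and only if there is such a tuple of numerical monoids $M_1,\dots,M_m$ (that is, with $c(M_i)\le c_i$ for each $i$ and $\sum_i g(M_i)=g$) such that \[ k_d=\#\{\,i\mid d\in M_i\text{ and }d<c_i\,\} \] for all $d\ge1$.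
   Context: For a vector $\mathbf{c}=(c_1,\dots,c_m)$ of positive integers let $A^+_{\mathbf{c}}=\mathbb{Z}[t_1,\dots,t_m]/(t_i^{c_i},\ t_it_j : i\neq j)$. The territory $\mathrm{Ter}^g_{\mathbf{c}}$ is the projective $\mathbb{Z}$-scheme representing the functor sending $S$ to the set of quasi-coherent $\mathcal{O}_S$-subalgebras $\mathscr{B}\subseteq A^+_{\mathbf{c}}\otimes\mathcal{O}_S$ with $(A^+_{\mathbf{c}}\otimes\mathcal{O}_S)/\mathscr{B}$ locally free of rank $g$. The torus $T=(\mathbb{G}_m)^m$ acts on $A^+_{\mathbf{c}}$ by $(\lambda_1,\dots,\lambda_m)\cdot f(t_1,\dots,t_m)=f(\lambda_1t_1,\dots,\lambda_mt_m)$ on $S$-points, hence on $\mathrm{Ter}^g_{\mathbf{c}}$ by taking images of subalgebras; ''$T$-fixed'' and ''$T$-invariant'' refer to this action of the group scheme $T$. With $\mathfrak{m}$ the ideal $(t_1,\dots,t_m)$ (and $\mathfrak{m}^d$ the whole algebra for $d\le0$), the vanishing sequence of a $k$-point $B$ of $\mathrm{Ter}^g_{\mathbf{c}}$ is the sequence $(k_d)_{d\in\mathbb{Z}}$ with $k_d=\dim_k\big((B\cap\mathfrak{m}^d)/(B\cap\mathfrak{m}^{d+1})\big)$. The stratum with vanishing sequence $(k_d)$, denoted $\mathcal{Z}_{(k_d)}$, is the locally closed subscheme of $\mathrm{Ter}^g_{\mathbf{c}}$ on which, for the universal subalgebra $\mathscr{B}$, $(\mathscr{B}\cap\mathfrak{m}^d)/(\mathscr{B}\cap\mathfrak{m}^{d+1})$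 is locally free of rank $k_d$ for each $d$. A numerical monoid is a submonoid $M$ of $\mathbb{N}=\{0,1,2,\dots\}$ with $\mathbb{N}\setminus M$ finite; its conductor $c(M)$ is the smallest integer with $c(M)+\mathbb{N}\subseteq M$, and its genus $g(M)$ is the size of $\mathbb{N}\setminus M$.
   Formalization: In (3) the sequence (k_d) is assumed to satisfy k_0 = 1 and k_d = 0 for d < 0, as every vanishing sequence does; without this the ''if'' direction fails, since the condition on the monoids only constrains d ≥ 1. *)

(* Defs.v *)
From HB Require Import structures.
From mathcomp Require Import all_boot all_order all_algebra.
From mathcomp Require Import boolp classical_sets functions cardinality finmap.
From mathcomp Require Import mpoly.

Set Implicit Arguments.
Unset Strict Implicit.
Unset Printing Implicit Defensive.

Import GRing.Theory.
Local Open Scope classical_set_scope.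
Local Open Scope ring_scope.

(* The algebra A^+_c (x) R = R[t_1, .., t_m] / (t_i ^ c_i, t_i t_j : i != j),
   on its basis of monomials: [None] stands for 1, and [Some (i, j)] for
   t_i ^ j.+1, where j.+1 < c i. [Aplus_presentation] below proves that this
   is the stated quotient of the polynomial ring. *)
Definition mono_idx (m : nat) (c : 'I_m -> nat) : finType :=
  option {i : 'I_m & 'I_(c i).-1}.

Definition mono (m : nat) (c : 'I_m -> nat) (i : 'I_m) (j : 'I_(c i).-1) :
  mono_idx c := Some (Tagged (fun i => 'I_(c i).-1) j).

Definition Aplus (m : nat) (c : 'I_m -> nat) (R : comNzRingType) : Type :=
  {ffun mono_idx c -> R}.

Section AplusAlgebra.
Context (m : nat) (c : 'I_m -> nat) (R : comNzRingType).
Local Notation A := (Aplus c R).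

HB.instance Definition _ := GRing.Lmodule.copy A {ffun mono_idx c -> R^o}.

(* f(0, .., 0, t_i, 0, .., 0) as a polynomial in t_i *)
Definition branch (f : A) (i : 'I_m) : {poly R} :=
  (f None)%:P + \sum_(j < (c i).-1) f (mono j) *: 'X^(j.+1).

Definition Aplus_one : A := [ffun b => (b == None)%:R].

Definition Aplus_mul (f g : A) : A :=
  [ffun b : mono_idx c =>
     match b return R with
     | Some p => (branch f (tag p) * branch g (tag p))`_(tagged p).+1
     | None => f None * g None
     end].

Definition tvar (i : 'I_m) : A :=
  [ffun b : mono_idx c =>
     match b return R with
     | Some p => ((tag p == i) && (tagged p == 0%N :> nat))%:R
     | None => 0
     end].

Lemma AplusP (f g : A) : f None = g None ->
  (forall i (j : 'I_(c i).-1), f (mono j) = g (mono j)) -> f = g.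
Proof. by move=> h0 h; apply/ffunP => -[[i j]|] //; exact: h. Qed.

Lemma branch0 (f : A) i : (branch f i)`_0 = f None.
Proof.
rewrite coefD coefC eqxx coef_sum big1 ?addr0 // => j _.
by rewrite coefZ coefXn mulr0.
Qed.

Lemma branchS (f : A) i (j : 'I_(c i).-1) : (branch f i)`_j.+1 = f (mono j).
Proof.
rewrite coefD coefC /= add0r coef_sum (bigD1 j) //= coefZ coefXn eqxx mulr1.
rewrite big1 ?addr0 // => k kj; rewrite coefZ coefXn eqSS eq_sym.
by rewrite (inj_eq val_inj) (negPf kj) mulr0.
Qed.

Lemma branch_mul (f g : A) i k : (k <= (c i).-1)%N ->
  (branch (Aplus_mul f g) i)`_k = (branch f i * branch g i)`_k.
Proof.
case: k => [_|k hk]; first by rewrite coef0M !branch0 ffunE.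
by rewrite -[k]/(val (Ordinal hk)) branchS ffunE.
Qed.

Lemma branch_mulC (f g : A) : Aplus_mul f g = Aplus_mul g f.
Proof.
by apply: AplusP => [|i j]; rewrite [LHS]ffunE [RHS]ffunE /= mulrC.
Qed.

Lemma branch_one i : branch Aplus_one i = 1.
Proof.
rewrite /branch ffunE eqxx big1 ?addr0 // => j _.
by rewrite ffunE scale0r.
Qed.

Lemma branchD (f g : A) i : branch (f + g) i = branch f i + branch g i.
Proof.
rewrite /branch ffunE polyCD addrACA -big_split; congr (_ + _).
by apply: eq_bigr => j _; rewrite ffunE scalerDl.
Qed.

Lemma branchZ a (f : A) i : branch (a *: f) i = a *: branch f i.
Proof.
rewrite /branch ffunE scalerDr scaler_sumr -mul_polyC -polyCM; congr (_ + _).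
by apply: eq_bigr => j _; rewrite ffunE scalerA.
Qed.

Lemma coef_mul_trunc (p p' q : {poly R}) n :
  (forall k, (k <= n)%N -> p`_k = p'`_k) -> (p * q)`_n = (p' * q)`_n.
Proof.
move=> h; rewrite !coefM; apply: eq_bigr => k _; rewrite h //.
exact: (ltn_ord k).
Qed.

Lemma Aplus_mulA : associative Aplus_mul.
Proof.
move=> f g h; apply: AplusP => [|i j]; first by rewrite !ffunE mulrA.
rewrite ffunE [RHS]ffunE /= mulrC.
rewrite (@coef_mul_trunc _ (branch g i * branch h i)).
  rewrite [RHS](@coef_mul_trunc _ (branch f i * branch g i)).
    by rewrite mulrC mulrA.
  by move=> k hk; apply: branch_mul; apply: leq_trans hk _.
by move=> k hk; apply: branch_mul; apply: leq_trans hk _.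
Qed.

Lemma Aplus_mul1 : left_id Aplus_one Aplus_mul.
Proof.
move=> f; apply: AplusP => [|i j]; first by rewrite !ffunE eqxx mul1r.
by rewrite ffunE /= branch_one mul1r branchS.
Qed.

Lemma Aplus_mulD : left_distributive Aplus_mul +%R.
Proof.
move=> f g h; apply: AplusP => [|i j]; first by rewrite !ffunE mulrDl.
by rewrite !ffunE /= branchD mulrDl coefD.
Qed.

Lemma Aplus_one_neq0 : Aplus_one != 0.
Proof.
by apply/eqP => /ffunP/(_ None); rewrite !ffunE eqxx; apply/eqP/oner_neq0.
Qed.

HB.instance Definition _ := GRing.Zmodule_isComNzRing.Build A
  Aplus_mulA branch_mulC Aplus_mul1 Aplus_mulD Aplus_one_neq0.

Lemma Aplus_scaleE (a : R) (f : A) b : (a *: f) b = a * f b.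
Proof. by rewrite ffunE. Qed.

Lemma Aplus_scaleAl (a : R) (f g : A) : a *: (f * g) = (a *: f) * g.
Proof.
apply: AplusP => [|i j]; rewrite Aplus_scaleE [in LHS]ffunE [RHS]ffunE /=.
  by rewrite Aplus_scaleE mulrA.
by rewrite branchZ -scalerAl coefZ.
Qed.

HB.instance Definition _ := GRing.Lmodule_isLalgebra.Build R A Aplus_scaleAl.
HB.instance Definition _ := GRing.Lalgebra_isComAlgebra.Build R A.

Lemma coef_tvarM0 i (f : A) : (tvar i * f) None = 0.
Proof. by rewrite !ffunE mul0r. Qed.

Lemma coef_tvarM i (f : A) i' (j : 'I_(c i').-1) :
  (tvar i * f) (mono j) = if i' == i then (branch f i')`_j else 0.
Proof.
rewrite ffunE /=.
have hj : (0 < (c i').-1)%N by apply: leq_trans (ltn_ord j).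
have -> : branch (tvar i) i' = (i' == i)%:R *: 'X.
  rewrite /branch ffunE add0r (bigD1 (Ordinal hj)) //= ffunE /= andbT expr1.
  rewrite big1 ?addr0 // => k hk; rewrite ffunE /=.
  suff -> : (k == 0%N :> nat) = false; first by rewrite andbF scale0r.
  by apply: negbTE; apply: contra hk => /eqP h; apply/eqP/val_inj.
rewrite -scalerAl coefZ coefXM /=.
by case: eqP; rewrite ?mul1r ?mul0r.
Qed.

Lemma coef_tvarX0 i k : (tvar i ^+ k.+1 : A) None = 0.
Proof. by rewrite exprS coef_tvarM0. Qed.

Lemma coef_tvarX i k i' (j : 'I_(c i').-1) :
  (tvar i ^+ k.+1 : A) (mono j) = ((i' == i) && (j == k :> nat))%:R.
Proof.
elim: k i' j => [|k IH] i' j; first by rewrite expr1 ffunE.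
rewrite exprS coef_tvarM; case: eqP => //= hi.
case: j => -[|j] hj /=; first by rewrite branch0 coef_tvarX0.
have hj' : (j < (c i').-1)%N by apply: ltnW.
by rewrite -[j]/(val (Ordinal hj')) branchS IH /= hi eqxx eqSS.
Qed.

Definition relation_ideal (p : {mpoly R[m]}) : Prop :=
  exists (u : 'I_m -> {mpoly R[m]}) (v : 'I_m -> 'I_m -> {mpoly R[m]}),
    p = \sum_i u i * 'X_i ^+ c i
        + \sum_i \sum_(j | j != i) v i j * ('X_i * 'X_j).

Lemma relation_ideal0 : relation_ideal 0.
Proof.
exists (fun=> 0), (fun _ _ => 0).
rewrite big1 ?add0r; last by move=> i _; rewrite mul0r.
by rewrite big1 // => i _; rewrite big1 // => j _; rewrite mul0r.
Qed.

Lemma relation_idealD p q :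
  relation_ideal p -> relation_ideal q -> relation_ideal (p + q).
Proof.
move=> [u [v ->]] [u' [v' ->]].
exists (fun i => u i + u' i), (fun i j => v i j + v' i j).
rewrite addrACA; congr (_ + _); rewrite -big_split; apply: eq_bigr => i _.
  by rewrite mulrDl.
by rewrite -big_split; apply: eq_bigr => j _; rewrite mulrDl.
Qed.

Lemma relation_idealM p q : relation_ideal q -> relation_ideal (p * q).
Proof.
move=> [u [v ->]]; exists (fun i => p * u i), (fun i j => p * v i j).
rewrite mulrDr !mulr_sumr; congr (_ + _); apply: eq_bigr => i _.
  by rewrite mulrA.
by rewrite mulr_sumr; apply: eq_bigr => j _; rewrite mulrA.
Qed.

Lemma relation_ideal_sum (I : Type) (r : seq I) (P : pred I) F :
  (forall i, P i -> relation_ideal (F i)) ->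
  relation_ideal (\sum_(i <- r | P i) F i).
Proof.
move=> h; apply: (big_ind relation_ideal) => //.
  exact: relation_ideal0.
exact: relation_idealD.
Qed.

Lemma relation_idealX i n : (c i <= n)%N -> relation_ideal ('X_i ^+ n).
Proof.
move=> hn; rewrite -(subnK hn) exprD; apply: relation_idealM.
exists (fun j => (j == i)%:R), (fun _ _ => 0).
rewrite (bigD1 i) //= eqxx mul1r big1 ?addr0; last first.
  by move=> j /negPf ->; rewrite mul0r.
rewrite big1 ?addr0 // => j _; rewrite big1 // => l _; exact: mul0r.
Qed.

Lemma relation_idealXX i j : j != i -> relation_ideal ('X_i * 'X_j).
Proof.
move=> hij; exists (fun _ => 0), (fun i' j' => ((i' == i) && (j' == j))%:R).
rewrite big1 ?add0r; last by move=> l _; rewrite mul0r.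
rewrite (bigD1 i) //= [X in _ + X]big1 ?addr0; last first.
  by move=> l /negPf ->; rewrite big1 // => l' _; rewrite mul0r.
rewrite (bigD1 j) //= !eqxx mul1r big1 ?addr0 // => l /andP[_ /negPf ->].
by rewrite andbF mul0r.
Qed.

Definition Aplus_pi (p : {mpoly R[m]}) : A := mmap (in_alg A) tvar p.
HB.instance Definition _ := GRing.RMorphism.copy Aplus_pi
  (mmap (in_alg A) tvar).

Lemma Aplus_piX i : Aplus_pi 'X_i = tvar i.
Proof. by rewrite /Aplus_pi mmapX mmap1U. Qed.

Lemma Aplus_piC a : Aplus_pi a%:MP = a%:A.
Proof. by rewrite /Aplus_pi mmapC. Qed.

Definition Aplus_lift (f : A) : {mpoly R[m]} :=
  (f None)%:MP + \sum_i \sum_(j < (c i).-1) f (mono j) *: 'X_i ^+ j.+1.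

Lemma Aplus_piZ a p : Aplus_pi (a *: p) = a *: Aplus_pi p.
Proof. by rewrite -mul_mpolyC rmorphM /= Aplus_piC -scalerAl mul1r. Qed.

Lemma Aplus_liftK f : Aplus_pi (Aplus_lift f) = f.
Proof.
rewrite /Aplus_lift rmorphD rmorph_sum /= Aplus_piC.
under eq_bigr => i _ do (rewrite rmorph_sum /=;
  under eq_bigr => j _ do rewrite Aplus_piZ rmorphXn /= Aplus_piX).
apply: AplusP => [|i j]; rewrite ffunE Aplus_scaleE sum_ffunE !ffunE /=.
  rewrite mulr1 big1 ?addr0 // => i _; rewrite sum_ffunE big1 // => j _.
  by rewrite Aplus_scaleE coef_tvarX0 mulr0.
rewrite mulr0 add0r (bigD1 i) //= [X in _ + X]big1 ?addr0; last first.
  move=> l hl; rewrite sum_ffunE big1 // => n _.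
  by rewrite Aplus_scaleE coef_tvarX eq_sym (negPf hl) mulr0.
rewrite sum_ffunE (bigD1 j) //= [X in _ + X]big1 ?addr0; last first.
  move=> l hl; rewrite Aplus_scaleE coef_tvarX eqxx /=.
  by rewrite eq_sym (inj_eq val_inj) (negPf hl) mulr0.
by rewrite Aplus_scaleE coef_tvarX !eqxx mulr1.
Qed.

Context (hc : forall i, (0 < c i)%N).

Lemma Aplus_pi_pow i : tvar i ^+ c i = 0.
Proof.
rewrite -(prednK (hc i)); apply: AplusP => [|i' j].
  by rewrite coef_tvarX0 ffunE.
rewrite coef_tvarX ffunE; case: eqP => //= hi.
by subst i'; rewrite (ltn_eqF (ltn_ord j)).
Qed.

Lemma Aplus_tvarM i j : j != i -> tvar i * tvar j = 0.
Proof.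
move=> hij; apply: AplusP => [|i' l]; first by rewrite coef_tvarM0 ffunE.
rewrite coef_tvarM ffunE; case: eqP => //= hi; subst i'.
case: l => -[|l] hl /=; first by rewrite branch0 ffunE.
have hl' : (l < (c i).-1)%N by apply: ltnW.
rewrite -[l]/(val (Ordinal hl')) branchS ffunE /=.
by rewrite eq_sym (negPf hij).
Qed.

(* X_i * lift f = lift (t_i * f) modulo the relations *)
Lemma Aplus_lift_tvarM i f :
  relation_ideal ('X_i * Aplus_lift f - Aplus_lift (tvar i * f)).
Proof.
rewrite /Aplus_lift coef_tvarM0 add0r mulrDr mulr_sumr.
rewrite (bigD1 i) //= [X in _ - X](bigD1 i) //=.
have -> : \sum_(i0 < m | i0 != i) \sum_(j < (c i0).-1)
    (tvar i * f) (mono j) *: 'X_i0 ^+ j.+1 = 0 :> {mpoly R[m]}.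
  apply: big1 => l hl; apply: big1 => j _.
  by rewrite coef_tvarM (negPf hl) scale0r.
rewrite addr0 addrA [_ - _]addrAC; apply: relation_idealD; last first.
  apply: relation_ideal_sum => l hl; rewrite mulr_sumr.
  apply: relation_ideal_sum => j _; rewrite -scalerAr exprS mulrA.
  rewrite -mul_mpolyC; apply: relation_idealM.
  by rewrite mulrC; apply: relation_idealM; apply: relation_idealXX.
have -> : 'X_i * (f None)%:MP + 'X_i * \sum_(j < (c i).-1)
    f (mono j) *: 'X_i ^+ j.+1
  = \sum_(j < (c i).-1.+1) (branch f i)`_j *: 'X_i ^+ j.+1 :> {mpoly R[m]}.
  rewrite big_ord_recl /= branch0 expr1 mulrC mul_mpolyC mulr_sumr.
  congr (_ + _); apply: eq_bigr => j _.
  by rewrite branchS -scalerAr -exprS.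
rewrite big_ord_recr /= addrAC.
have -> : \sum_(j < (c i).-1) (tvar i * f) (mono j) *: 'X_i ^+ j.+1
  = \sum_(j < (c i).-1) (branch f i)`_j *: 'X_i ^+ j.+1 :> {mpoly R[m]}.
  by apply: eq_bigr => j _; rewrite coef_tvarM eqxx.
rewrite subrr add0r -mul_mpolyC; apply: relation_idealM.
by apply: relation_idealX; rewrite prednK.
Qed.

Lemma Aplus_lift_piD p q : Aplus_lift (p + q) = Aplus_lift p + Aplus_lift q.
Proof.
rewrite /Aplus_lift ffunE mpolyCD addrACA -big_split; congr (_ + _).
apply: eq_bigr => i _; rewrite -big_split; apply: eq_bigr => j _.
by rewrite ffunE scalerDl.
Qed.

Lemma Aplus_lift1 a : Aplus_lift a%:A = a%:MP.
Proof.
rewrite /Aplus_lift Aplus_scaleE ffunE mulr1 big1 ?addr0 // => i _.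
by apply: big1 => j _; rewrite Aplus_scaleE ffunE mulr0 scale0r.
Qed.

Lemma Aplus_lift0 : Aplus_lift 0 = 0.
Proof. by have := Aplus_lift1 0; rewrite scale0r mpolyC0. Qed.

Lemma Aplus_lift_pi p : relation_ideal (p - Aplus_lift (Aplus_pi p)).
Proof.
have tvarM i q : relation_ideal (q - Aplus_lift (Aplus_pi q)) ->
    relation_ideal ('X_i * q - Aplus_lift (Aplus_pi ('X_i * q))).
  move=> hq; rewrite rmorphM /= Aplus_piX.
  rewrite -[X in X - _](subrK ('X_i * Aplus_lift (Aplus_pi q))) -addrA.
  apply: relation_idealD; last exact: Aplus_lift_tvarM.
  by rewrite -mulrBr; apply: relation_idealM.
elim/mpolyind: p => [|a n p _ _ hp].
  rewrite rmorph0 Aplus_lift0 subr0.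
  exact: relation_ideal0.
rewrite rmorphD /= Aplus_lift_piD opprD addrACA.
apply: relation_idealD hp; rewrite -mul_mpolyC mulrC mpolyXE_id.
have : relation_ideal (a%:MP - Aplus_lift (Aplus_pi a%:MP)).
  by rewrite Aplus_piC Aplus_lift1 subrr; exact: relation_ideal0.
move: (a%:MP) => q hq; elim: (index_enum _) => [|i r IH].
  by rewrite big_nil mul1r.
rewrite big_cons -mulrA; move: (\prod_(_ <- _) _ * q) IH => q' hq'.
elim: (n i) => [|e IHe]; first by rewrite expr0 mul1r.
by rewrite exprS -mulrA; apply: tvarM.
Qed.

Theorem Aplus_presentation :
  exists pi : {rmorphism {mpoly R[m]} -> A},
    [/\ forall a, pi a%:MP = a%:A, forall i, pi 'X_i = tvar i,
        forall f, exists p, pi p = f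
      & forall p, pi p = 0 <-> relation_ideal p].
Proof.
exists Aplus_pi; split=> [a|i|f|p]; rewrite /=.
- exact: Aplus_piC.
- exact: Aplus_piX.
- by exists (Aplus_lift f); apply: Aplus_liftK.
- split=> [hp|[u [v ->]]].
    by have := Aplus_lift_pi p; rewrite hp Aplus_lift0 subr0.
  rewrite rmorphD !rmorph_sum /= big1 ?add0r => [|i _]; last first.
    by rewrite rmorphM rmorphXn /= Aplus_piX Aplus_pi_pow mulr0.
  apply: big1 => i _; rewrite rmorph_sum big1 //= => j hj.
  by rewrite !rmorphM /= !Aplus_piX Aplus_tvarM // mulr0.
Qed.

End AplusAlgebra.

Section AplusFunctoriality.
Context (m : nat) (c : 'I_m -> nat).

(* A^+_c (x) R -> A^+_c (x) R' *)
Definition Aplus_map (R R' : comNzRingType) (phi : {rmorphism R -> R'})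
  (f : Aplus c R) : Aplus c R' := [ffun b => phi (f b)].

(* f(t_1, .., t_m) |-> f(lambda_1 t_1, .., lambda_m t_m) *)
Definition torus_act (R : comNzRingType) (lambda : 'I_m -> R)
  (f : Aplus c R) : Aplus c R :=
  [ffun b : mono_idx c =>
     match b return R with
     | Some p => lambda (tag p) ^+ (tagged p).+1 * f b
     | None => f b
     end].

Lemma branch_map (R R' : comNzRingType) (phi : {rmorphism R -> R'})
  (f : Aplus c R) i : branch (Aplus_map phi f) i = map_poly phi (branch f i).
Proof.
rewrite /branch rmorphD /= map_polyC rmorph_sum ffunE; congr (_ + _).
by apply: eq_bigr => j _; rewrite ffunE /= linearZ /= map_polyXn.
Qed.

Lemma Aplus_map_is_zmod_morphism (R R' : comNzRingType)
  (phi : {rmorphism R -> R'}) : zmod_morphism (Aplus_map phi).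
Proof. by move=> f g; apply/ffunP => b; rewrite !ffunE rmorphB. Qed.

Lemma Aplus_map_is_monoid_morphism (R R' : comNzRingType)
  (phi : {rmorphism R -> R'}) : monoid_morphism (Aplus_map phi).
Proof.
split=> [|f g]; first by apply/ffunP => b; rewrite !ffunE rmorph_nat.
apply: AplusP => [|i j]; rewrite ffunE [in LHS]ffunE [RHS]ffunE.
  by rewrite !ffunE rmorphM.
by rewrite /= !branch_map -rmorphM coef_map.
Qed.

Lemma Aplus_mapZ (R R' : comNzRingType) (phi : {rmorphism R -> R'}) a
  (f : Aplus c R) : Aplus_map phi (a *: f) = phi a *: Aplus_map phi f.
Proof. by apply/ffunP => b; rewrite !(ffunE, Aplus_scaleE) rmorphM. Qed.

Lemma Aplus_map_tvar (R R' : comNzRingType) (phi : {rmorphism R -> R'}) i :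
  Aplus_map phi (tvar c R i) = tvar c R' i.
Proof.
by apply: AplusP => [|i' j]; rewrite !ffunE /= ?rmorph0 ?rmorph_nat.
Qed.

Context (R : comNzRingType) (lambda : 'I_m -> R).

Lemma coef_branch_torus_act (f : Aplus c R) i k :
  (branch (torus_act lambda f) i)`_k = lambda i ^+ k * (branch f i)`_k.
Proof.
case: k => [|k]; first by rewrite !branch0 ffunE mul1r.
have [hk|hk] := ltnP k (c i).-1.
  by rewrite -[k]/(val (Ordinal hk)) !branchS ffunE.
suff h (g : Aplus c R) : (branch g i)`_k.+1 = 0 by rewrite !h mulr0.
rewrite coefD coefC add0r coef_sum big1 // => j _.
rewrite coefZ coefXn eqSS; suff -> : (k == j) = false by rewrite mulr0.
by apply/eqP => kj; move: (ltn_ord j); rewrite -kj ltnNge hk.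
Qed.

Lemma torus_act_is_zmod_morphism : zmod_morphism (torus_act lambda).
Proof. by move=> f g; apply/ffunP => -[p|]; rewrite !ffunE //= mulrBr. Qed.

Lemma torus_act_is_monoid_morphism : monoid_morphism (torus_act lambda).
Proof.
split=> [|f g]; first by apply/ffunP => -[p|]; rewrite !ffunE //= mulr0.
apply: AplusP => [|i j]; rewrite ffunE ?[in LHS]ffunE [RHS]ffunE.
  by rewrite !ffunE.
rewrite /= !coefM mulr_sumr; apply: eq_bigr => k _.
rewrite !coef_branch_torus_act mulrACA -exprD subnKC //.
by rewrite -ltnS ltn_ord.
Qed.

Lemma torus_actZ a (f : Aplus c R) :
  torus_act lambda (a *: f) = a *: torus_act lambda f.
Proof.
by apply/ffunP => -[p|]; rewrite !(ffunE, Aplus_scaleE) //= mulrCA.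
Qed.

Lemma torus_act_tvar i : torus_act lambda (tvar c R i) = lambda i *: tvar c R i.
Proof.
apply: AplusP => [|i' j]; rewrite Aplus_scaleE !ffunE /= ?mulr0 //.
case: eqP => [<-|] /=; last by rewrite !mulr0.
by case: eqP => [->|] /=; rewrite ?expr1 ?mulr0.
Qed.

End AplusFunctoriality.

Section LocallyFree.
Context (R : comNzRingType) (V : lmodType R).

(* The localization of E / W at the powers of a is free of rank n, with basis
   the images of the e j; bases of this form exist as soon as bases do. *)
Definition free_quot_away (a : R) (E W : set V) (n : nat) : Prop :=
  exists e : 'I_n -> V,
    [/\ forall j, E (e j),
        forall x, E x -> exists (N : nat) (u : 'I_n -> R),
          W (a ^+ N *: x - \sum_j u j *: e j)
      & forall (N : nat) (u : 'I_n -> R), W (a ^+ N *: \sum_j u j *: e j) ->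
          exists N' : nat, forall j, a ^+ N' * u j = 0].

(* E / W is locally free of rank n on Spec R *)
Definition locally_free_quot (E W : set V) (n : nat) : Prop :=
  exists (s : nat) (a : 'I_s -> R),
    (exists u : 'I_s -> R, \sum_l u l * a l = 1) /\
    forall l, free_quot_away (a l) E W n.

End LocallyFree.

(* dim_k (E / W) = n, for subspaces W of E *)
Definition quot_dim (k : fieldType) (V : lmodType k) (E W : set V) (n : nat) :
  Prop :=
  exists e : 'I_n -> V,
    [/\ forall j, E (e j),
        forall x, E x -> exists u : 'I_n -> k, W (x - \sum_j u j *: e j)
      & forall u : 'I_n -> k, W (\sum_j u j *: e j) -> forall j, u j = 0].

Definition lin_span (R : comNzRingType) (V : lmodType R) (S : set V) : set V :=
  [set x | exists (n : nat) (u : 'I_n -> R) (y : 'I_n -> V),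
     (forall j, S (y j)) /\ x = \sum_j u j *: y j].

Section Territory.
Context (m : nat) (c : 'I_m -> nat).

(* Test rings carry a unitRingType structure only so that units can be
   inverted; the zero ring, whose spectrum is empty, is not a test ring. *)
Definition Ter (g : nat) (R : comUnitRingType) : set (set (Aplus c R)) :=
  [set B | GRing.subalg_closed (mem B) /\ locally_free_quot setT B g].

(* When the quotient by B is locally free, B (x) R' is a submodule of
   A^+_c (x) R', generated by the image of B. *)
Definition base_change (R R' : comUnitRingType) (phi : {rmorphism R -> R'})
  (B : set (Aplus c R)) : set (Aplus c R') := lin_span (Aplus_map phi @` B).

Definition torus (R : comUnitRingType) : set ('I_m -> R) :=
  [set lambda | forall i, lambda i \is a GRing.unit].

Definition T_fixed (k : fieldType) (B : set (Aplus c k)) : Prop :=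
  forall (R : comUnitRingType) (phi : {rmorphism k -> R}) (lambda : 'I_m -> R),
    torus lambda ->
    torus_act lambda @` base_change phi B = base_change phi B.

(* Closed subschemes Z of Ter^g_c (x) k, as closed subfunctors: the pullback of
   Z along each R-point of Ter^g_c is the closed subscheme of Spec R cut out by
   some set of equations I. A k-algebra is given by its structure morphism. *)
Definition Ter_closed (k : fieldType) (g : nat)
  (Z : forall R : comUnitRingType, {rmorphism k -> R} -> set (set (Aplus c R))) :
  Prop :=
  (forall (R : comUnitRingType) (iota : {rmorphism k -> R}),
     Z R iota `<=` Ter g (R := R)) /\
  (forall (R : comUnitRingType) (iota : {rmorphism k -> R}) B, Ter g B ->
     exists I : set R,
       forall (R' : comUnitRingType) (iota' : {rmorphism k -> R'})
         (psi : {rmorphism R -> R'}), (forall a, psi (iota a) = iota' a) ->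
         Z R' iota' (base_change psi B) <-> (forall x, I x -> psi x = 0)).

(* The k-points of the closure in Ter^g_c (x) k of the T-orbit of the point
   given by B, which has values in an extension kappa : k -> K. The closure is
   the intersection of the closed subschemes through which the orbit map
   lambda |-> lambda . B, from T (x) K to Ter^g_c (x) k, factors. *)
Definition orbit_closure (k K : fieldType) (kappa : {rmorphism k -> K})
  (g : nat) (B : set (Aplus c K)) : set (set (Aplus c k)) :=
  [set F | Ter g F /\
     forall Z : forall R : comUnitRingType,
                  {rmorphism k -> R} -> set (set (Aplus c R)),
       Ter_closed g Z ->
       (forall (R : comUnitRingType) (iota : {rmorphism k -> R})
          (psi : {rmorphism K -> R}) (lambda : 'I_m -> R),
          (forall a, psi (kappa a) = iota a) -> torus lambda ->
          Z R iota (torus_act lambda @` base_change psi B)) ->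
       Z k idfun F].

Definition max_ideal (R : comNzRingType) : set (Aplus c R) :=
  [set x | exists u : 'I_m -> Aplus c R, x = \sum_i u i * tvar c R i].

Definition ideal_mul (A : comNzRingType) (I J : set A) : set A :=
  [set x | exists (n : nat) (u v : 'I_n -> A),
     [/\ forall l, I (u l), forall l, J (v l) & x = \sum_l u l * v l]].

Definition max_ideal_pow (R : comNzRingType) (d : int) : set (Aplus c R) :=
  if d is Posz n then iter n (ideal_mul (max_ideal (R := R))) setT else setT.

Definition vanishing_sequence (k : fieldType) (B : set (Aplus c k))
  (kd : int -> nat) : Prop :=
  forall d : int, quot_dim (B `&` max_ideal_pow d)
                           (B `&` max_ideal_pow (d + 1)) (kd d).

(* The k-points of the stratum with vanishing sequence kd *)
Definition stratum (g : nat) (k : fieldType) (kd : int -> nat) :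
  set (set (Aplus c k)) :=
  [set B | Ter g B /\ vanishing_sequence B kd].

End Territory.

Definition numerical_monoid (M : set nat) : Prop :=
  [/\ M 0%N, forall a b, M a -> M b -> M (a + b)%N & finite_set (~` M)].

Definition conductor (M : set nat) : nat :=
  xget 0%N [set n | (forall a, M (n + a)%N) /\
                    forall n', (forall a, M (n' + a)%N) -> (n <= n')%N].

Definition genus (M : set nat) : nat := #|` fset_set (~` M)|%fset.

Definition monoid_tuples (m : nat) (c : 'I_m -> nat) (g : nat) :
  set ('I_m -> set nat) :=
  [set M | [/\ forall i, numerical_monoid (M i),
               forall i, (conductor (M i) <= c i)%N
             & (\sum_i genus (M i))%N = g]].

(* Main.v *)
(* Give t_i^j the weight j w_i, with w_1, .., w_m chosen so that weights are
   distinct and refine the degree. Gaussian elimination from the lowest weight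
   up writes a subalgebra B over a field as the span of elements b_mu, with
   lowest term mu running through a set S of monomials, and S is closed under
   nonzero products because B is. The span of S is the limit for x -> 0 of
   x^w . B: dividing x^w . b_mu by x^(w mu) gives a family over K[x] which is
   x^w . B generically and the span of S at x = 0. It is fixed by T, so the
   orbit closure contains a fixed point; conversely, invariance of B under x^w
   over K(x) forces b_mu = mu, so the fixed points are the spans of monomials,
   and these amount to tuples of numerical monoids. Since weights refine the
   degree, B and the span of S have the same vanishing sequence, which counts
   the elements of S in each degree. *)
Require Import Defs.
From mathcomp Require Import all_boot all_order all_algebra.
From mathcomp Require Import boolp classical_sets functions cardinality finmap.
From mathcomp Require Import fraction zify.

Set Implicit Arguments.
Unset Strict Implicit.
Unset Printing Implicit Defensive.

Import GRing.Theory.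
Local Open Scope classical_set_scope.
Local Open Scope ring_scope.

Lemma enum_val_extend (T : finType) (U : Type) (A : {set T}) (x : U)
    (u : 'I_#|A| -> U) : exists v : T -> U, forall j, v (enum_val j) = u j.
Proof.
exists (fun y => if [pick j | enum_val j == y] is Some j then u j else x) => j.
by case: pickP => [j' /eqP/enum_val_inj -> //|/(_ j)]; rewrite eqxx.
Qed.

(** * Subspaces over a field and dimensions of quotients *)

Section Subspaces.
Context (k : fieldType) (V : lmodType k).

Definition subspace (W : set V) : Prop :=
  W 0 /\ forall a x y, W x -> W y -> W (a *: x + y).

Lemma subspaceZ W a x : subspace W -> W x -> W (a *: x).
Proof. by move=> [W0 WD] Wx; rewrite -[_ *: _]addr0; apply: WD. Qed.

Lemma subspaceD W x y : subspace W -> W x -> W y -> W (x + y).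
Proof. by move=> [_ WD] Wx Wy; rewrite -[x]scale1r; apply: WD. Qed.

Lemma subspaceB W x y : subspace W -> W x -> W y -> W (x - y).
Proof. by move=> [_ WD] Wx Wy; rewrite addrC -scaleN1r; apply: WD. Qed.

Lemma subspace_sum W (I : Type) (r : seq I) (P : pred I)
    (u : I -> k) (v : I -> V) : subspace W ->
  (forall i, P i -> W (v i)) -> W (\sum_(i <- r | P i) u i *: v i).
Proof.
move=> [W0 WD] Wv; elim/big_rec: _ => // i x Pi Wx.
by apply: WD => //; apply: Wv.
Qed.

(** Writing each family in terms of the other modulo [W] gives matrices [MP] and [MQ]; independence
    of the [e j] modulo [W] makes their product the identity, and an identity matrix of size [n]
    factors through size [n'] only if [n <= n']. *)
Lemma quot_dim_leq (E W : set V) n n' :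
  subspace W -> quot_dim E W n -> quot_dim E W n' -> (n <= n')%N.
Proof.
move=> sW [e [Ee eg ef]] [e' [Ee' e'g _]].
have [P hP] := choice (fun j => e'g _ (Ee j)).
have [Q hQ] := choice (fun j => eg _ (Ee' j)).
pose MP := \matrix_(i, j) P i j; pose MQ := \matrix_(i, j) Q i j.
apply: (@mulmx1_min k n n' MP MQ); apply/matrixP => i j.
apply/eqP; rewrite -subr_eq0; apply/eqP.
move: j; apply: (ef (fun j => (MP *m MQ) i j - 1%:M i j)).
have -> : \sum_j ((MP *m MQ) i j - 1%:M i j) *: e j
    = \sum_l P i l *: (\sum_j Q l j *: e j) - e i.
  rewrite (eq_bigr (fun j => (MP *m MQ) i j *: e j - (i == j)%:R *: e j)).
    rewrite big_split /= sumrN; congr (_ - _).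
      transitivity (\sum_j \sum_l P i l *: (Q l j *: e j)).
        apply: eq_bigr => j _; rewrite mxE scaler_suml.
        by apply: eq_bigr => l _; rewrite !mxE scalerA.
      by rewrite exchange_big; apply: eq_bigr => l _; rewrite scaler_sumr.
    rewrite (bigD1 i) //= eqxx scale1r big1 ?addr0 // => j /negPf.
    by rewrite eq_sym => ->; rewrite scale0r.
  by move=> j _; rewrite !mxE scalerBl.
pose y := \sum_l P i l *: e' l; set x := \sum_l _.
have -> : x - e i = (-1) *: ((e i - y) + (y - x)).
  by rewrite addrA subrK scaleN1r opprB.
apply: subspaceZ => //; apply: subspaceD => //.
rewrite -sumrB (eq_bigr (fun l => P i l *: (e' l - \sum_j Q l j *: e j))).
  exact: subspace_sum.
by move=> l _; rewrite scalerBr.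
Qed.

Lemma quot_dim_inj (E W : set V) n n' :
  subspace W -> quot_dim E W n -> quot_dim E W n' -> n = n'.
Proof.
move=> sW h h'; apply/eqP; rewrite eqn_leq.
by rewrite (quot_dim_leq sW h h') (quot_dim_leq sW h' h).
Qed.

(** The [a l] generate the unit ideal, so over a field one of them is nonzero; its powers are
    invertible, and localizing there changes nothing. *)
Lemma locally_free_quot_dim (E W : set V) n :
  subspace W -> locally_free_quot E W n -> quot_dim E W n.
Proof.
move=> sW [s [a [[u ua] hl]]].
have [l al0] : exists l, a l != 0.
  apply/existsP; apply/contraT; rewrite negb_exists => /forallP a0.
  have /eqP : (0 : k) = 1; last by rewrite eq_sym oner_eq0.
  rewrite -ua big1 // => l _.
  by move: (a0 l); rewrite negbK => /eqP ->; rewrite mulr0.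
have [e [Ee eg ef]] := hl l; exists e; split=> // [x Ex|v Wv j].
  have [N [v Wv]] := eg x Ex; exists (fun j => (a l ^+ N)^-1 * v j).
  have aN0 : a l ^+ N != 0 by rewrite expf_neq0.
  suff -> : x - \sum_j ((a l ^+ N)^-1 * v j) *: e j
    = (a l ^+ N)^-1 *: (a l ^+ N *: x - \sum_j v j *: e j).
    exact: subspaceZ.
  rewrite scalerBr scalerA mulVf // scale1r; congr (_ - _).
  by rewrite scaler_sumr; apply: eq_bigr => j _; rewrite scalerA.
have [|N' /(_ j)/eqP] := ef 0 v; first by rewrite expr0 scale1r.
by rewrite mulf_eq0 expf_eq0 (negPf al0) andbF /= => /eqP.
Qed.

End Subspaces.

Lemma free_locally_free (R : comNzRingType) (V : lmodType R) (E W : set V) n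
    (e : 'I_n -> V) :
  (forall j, E (e j)) ->
  (forall x, E x -> exists u : 'I_n -> R, W (x - \sum_j u j *: e j)) ->
  (forall u : 'I_n -> R, W (\sum_j u j *: e j) -> forall j, u j = 0) ->
  locally_free_quot E W n.
Proof.
move=> Ee eg ef; exists 1%N, (fun=> 1); split.
  by exists (fun=> 1); rewrite big_ord1 mulr1.
move=> _; exists e; split=> // [x Ex|N u].
  by have [u Wu] := eg x Ex; exists 0%N, u; rewrite expr0 scale1r.
rewrite expr1n scale1r => /ef u0; exists 0%N => j.
by rewrite u0 mulr0.
Qed.

(** * Submodules in echelon form: quotients, base change, torus action *)

Section SpanGraph.
Context (m : nat) (c : 'I_m -> nat).
Local Notation I := (mono_idx c).
Implicit Types (S : {set I}).

Lemma Aplus_ext (R : comNzRingType) (f g : Aplus c R) :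
  (forall mu, f mu = g mu) -> f = g.
Proof. by move=> h; apply: AplusP. Qed.

Definition monomial (R : comNzRingType) (mu : I) : Aplus c R :=
  [ffun nu => (nu == mu)%:R].

(* A submodule in reduced echelon form: the coordinates in S are free and
   determine the others. *)
Definition span_graph (R : comNzRingType) S (b : I -> Aplus c R) :
  set (Aplus c R) := [set f | f = \sum_(mu in S) f mu *: b mu :> Aplus c R].

Definition reduced (R : comNzRingType) S (b : I -> Aplus c R) : Prop :=
  forall mu nu, mu \in S -> nu \in S -> b mu nu = (nu == mu)%:R.

Lemma reduced_monomial (R : comNzRingType) S : reduced S (monomial R).
Proof. by move=> mu nu _ _; rewrite ffunE. Qed.

Section Ring.
Context (R : comNzRingType) (S : {set I}) (b : I -> Aplus c R).

Lemma sum_coefE (P : pred I) (u : I -> R) nu :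
  (\sum_(mu | P mu) u mu *: b mu) nu = \sum_(mu | P mu) u mu * b mu nu.
Proof. by rewrite sum_ffunE; apply: eq_bigr => mu _; rewrite Aplus_scaleE. Qed.

Lemma span_graphP f : span_graph S b f <->
  forall nu, f nu = \sum_(mu in S) f mu * b mu nu.
Proof.
split=> [hf nu|hf]; first by rewrite {1}hf sum_coefE.
by apply: Aplus_ext => nu; rewrite sum_coefE.
Qed.

Lemma span_graph0 : span_graph S b 0.
Proof.
by apply/span_graphP => nu; rewrite ffunE big1 // => mu _; rewrite ffunE mul0r.
Qed.

Lemma span_graph_linear a f g :
  span_graph S b f -> span_graph S b g -> span_graph S b (a *: f + g).
Proof.
move=> /span_graphP hf /span_graphP hg; apply/span_graphP => nu.
rewrite ffunE Aplus_scaleE hf hg mulr_sumr -big_split; apply: eq_bigr => mu _.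
by rewrite ffunE Aplus_scaleE mulrDl mulrA.
Qed.

Lemma span_graph_lin_sum (J : Type) (r : seq J) (P : pred J) (u : J -> R)
    (v : J -> Aplus c R) : (forall j, P j -> span_graph S b (v j)) ->
  span_graph S b (\sum_(j <- r | P j) u j *: v j).
Proof.
move=> hv; elim/big_rec: _ => [|j x Pj hx]; first exact: span_graph0.
by apply: span_graph_linear => //; apply: hv.
Qed.

Context (rb : reduced S b).

Lemma reduced_sum (u : I -> R) nu : nu \in S ->
  \sum_(mu in S) u mu * b mu nu = u nu.
Proof.
move=> hnu; rewrite (bigD1 nu) //= rb // eqxx mulr1 big1 ?addr0 //.
by move=> mu /andP[hmu /negPf hn]; rewrite rb // eq_sym hn mulr0.
Qed.

Lemma span_graph_gen mu : mu \in S -> span_graph S b (b mu).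
Proof.
move=> hmu; apply/span_graphP => nu; rewrite (bigD1 mu) //=.
rewrite (rb hmu hmu) eqxx mul1r.
rewrite big1 ?addr0 // => ka /andP[hka /negPf hn].
by rewrite (rb hmu hka) hn mul0r.
Qed.

Lemma span_graph_sum (P : pred I) (u : I -> R) :
  (forall mu, P mu -> mu \in S) ->
  span_graph S b (\sum_(mu | P mu) u mu *: b mu).
Proof.
by move=> hP; apply: span_graph_lin_sum => mu /hP; apply: span_graph_gen.
Qed.

(** Any [f] differs from exactly one element of the span by a combination of monomials outside [S],
    namely from the one with the same coordinates in [S]. Those monomials are thus a basis of the
    quotient. *)
Lemma span_graph_locally_free :
  locally_free_quot setT (span_graph S b) #|~: S|.
Proof.
pose e (j : 'I_#|~: S|) := monomial R (enum_val j).
have sum_e (u : I -> R) : \sum_j u (enum_val j) *: e j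
    = \sum_(nu in ~: S) u nu *: monomial R nu :> Aplus c R.
  by rewrite [RHS]big_enum_val.
have sum_eE (u : I -> R) nu : (\sum_(mu in ~: S) u mu *: monomial R mu) nu
    = if nu \in S then 0 else u nu.
  rewrite sum_ffunE; case: ifPn => hnu.
    apply: big1 => mu; rewrite finset.in_setC Aplus_scaleE ffunE => hmu.
    by case: eqP hmu => [<-|_]; rewrite ?hnu ?mulr0.
  rewrite (bigD1 nu) ?finset.in_setC //= Aplus_scaleE ffunE eqxx mulr1.
  rewrite big1 ?addr0 //.
  move=> mu /andP[_ /negPf]; rewrite eq_sym Aplus_scaleE ffunE => ->.
  by rewrite mulr0.
apply: (free_locally_free (e := e)) => // [f _|u].
  pose u nu := f nu - \sum_(mu in S) f mu * b mu nu.
  exists (fun j => u (enum_val j)); rewrite sum_e; apply/span_graphP => nu.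
  rewrite (eq_bigr (fun mu => f mu * b mu nu)); last first.
    by move=> mu hmu; rewrite !ffunE sum_eE hmu subr0.
  rewrite !ffunE sum_eE; case: ifPn => hnu; first by rewrite subr0 reduced_sum.
  by rewrite opprB addrC subrK.
have [v vE] := enum_val_extend 0 u.
under eq_bigr => j _ do rewrite -vE.
rewrite sum_e => /span_graphP h j.
have := h (enum_val j); rewrite sum_eE.
have := enum_valP j; rewrite finset.in_setC => /negPf ->; rewrite vE => ->.
by rewrite big1 // => mu hmu; rewrite sum_eE hmu mul0r.
Qed.

End Ring.

Section BaseChange.
Context (R R' : comUnitRingType) (phi : {rmorphism R -> R'}).
Context (S : {set I}) (b : I -> Aplus c R).

(** The equations defining [span_graph] have coefficients [b mu nu], so [phi] carries them along;
    conversely, a solution over [R'] is by definition a combination of the images of the [b mu]. *)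
Lemma base_change_span_graph : reduced S b ->
  base_change phi (span_graph S b) = span_graph S (Aplus_map phi \o b).
Proof.
move=> rb; apply/seteqP; split=> [_ [n [u [y [hy ->]]]]|f hf].
  apply: span_graph_lin_sum => j _; have [f hf <-] := hy j.
  apply/span_graphP => nu; rewrite ffunE; move/span_graphP: hf => ->.
  by rewrite rmorph_sum; apply: eq_bigr => mu _; rewrite !ffunE rmorphM.
exists #|S|, (fun j => f (enum_val j)),
  (fun j => Aplus_map phi (b (enum_val j))).
split; last by rewrite {1}hf [LHS]big_enum_val.
move=> j; exists (b (enum_val j)) => //.
by apply: span_graph_gen => //; apply: enum_valP.
Qed.

End BaseChange.

Definition degree (mu : I) : nat := if mu is Some p then (tagged p).+1 else 0%N.

Definition character (R : comNzRingType) (lambda : 'I_m -> R) (mu : I) : R :=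
  if mu is Some p then lambda (tag p) ^+ (tagged p).+1 else 1.

Lemma torus_actE (R : comNzRingType) (lambda : 'I_m -> R) f mu :
  torus_act lambda f mu = character lambda mu * f mu.
Proof. by rewrite ffunE; case: mu => [p|] //=; rewrite mul1r. Qed.

Section Torus.
Context (R : comUnitRingType) (lambda : 'I_m -> R) (hl : torus lambda).

Lemma character_unit (mu : I) : character lambda mu \is a GRing.unit.
Proof. by case: mu => [p|] /=; rewrite ?unitr1 // unitrX //; apply: hl. Qed.

(** The hypothesis says that [lambda] sends [b mu] to [character lambda mu *: b' mu]; characters
    take unit values, so this rescaling of generators does not change the span. *)
Lemma torus_act_span_graph S (b b' : I -> Aplus c R) :
  (forall mu nu, mu \in S ->
     character lambda mu * b' mu nu = character lambda nu * b mu nu) ->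
  torus_act lambda @` span_graph S b = span_graph S b'.
Proof.
move=> hb; apply/seteqP; split=> [_ [f /span_graphP hf <-]|f /span_graphP hf].
  apply/span_graphP => nu; rewrite torus_actE hf mulr_sumr.
  by apply: eq_bigr => mu hmu; rewrite torus_actE mulrCA -hb // mulrCA mulrA.
pose f' : Aplus c R := [ffun mu => (character lambda mu)^-1 * f mu].
have f'E : torus_act lambda f' = f.
  by apply: Aplus_ext => mu; rewrite torus_actE ffunE mulVKr // character_unit.
exists f' => //; apply/span_graphP => nu.
apply: (mulrI (character_unit nu)); rewrite -torus_actE f'E hf mulr_sumr.
apply: eq_bigr => mu hmu; rewrite -{1}f'E torus_actE.
by rewrite [RHS]mulrCA -hb // [RHS]mulrCA mulrA.
Qed.

End Torus.

Lemma T_fixed_monomial (k : fieldType) S :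
  T_fixed (span_graph S (monomial k)).
Proof.
move=> R phi lambda hl; rewrite base_change_span_graph; last first.
  exact: reduced_monomial.
apply: torus_act_span_graph => // mu nu hmu; rewrite !ffunE.
by case: eqP => [->|] //; rewrite rmorph0 !mulr0.
Qed.

End SpanGraph.

(** * An injective weight on monomials that refines the degree *)

Section Weight.
Context (m : nat) (c : 'I_m -> nat).
Local Notation I := (mono_idx c).

(* The increments [i] make weights injective, and the constant term is large
   enough for the weight to refine the degree. *)
Definition slope (i : 'I_m) : nat := (m * (\max_j c j) + i).+1.

Definition weight (mu : I) : nat :=
  if mu is Some p then ((tagged p).+1 * slope (tag p))%N else 0%N.

Lemma degree_bound (mu : I) : (degree mu <= \max_j c j)%N.
Proof.
case: mu => [[i [j hj]]|] //=; apply: leq_trans (leq_bigmax i).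
by apply: leq_trans hj (leq_pred _).
Qed.

Lemma weight_degree (mu nu : I) :
  (degree mu < degree nu)%N -> (weight mu < weight nu)%N.
Proof.
have := degree_bound mu; case: mu => [[i j]|]; case: nu => [[i' j']|] //=.
  move: (nat_of_ord j) (nat_of_ord j') => a a'; rewrite /slope => ha haa.
  have hi := ltn_ord i; apply: leq_trans (leq_mul haa (leqnn _)).
  (* The degree [a.+1] is at most [\max_j c j] and [i < m], so the increment [i] contributes at most
     [m * \max_j c j] in total, less than what one more degree adds. *)
  have : (a.+1 * i <= m * \max_j c j)%N by rewrite mulnC leq_mul // ltnW.
  move: (m * _)%N (nat_of_ord i) (nat_of_ord i') => D e e' h.
  apply: leq_trans (leq_mul (leqnn _) (leq_addr e' D.+1)).
  by rewrite mulSn addSn mulnS mulnDr mulSn; lia.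
Qed.

(** By [weight_degree] equal weights force equal degrees; dividing by the degree leaves equal
    slopes, and these determine [i]. *)
Lemma weight_inj : injective weight.
Proof.
move=> mu nu hw.
have hd : degree mu = degree nu.
  have [h|h|//] := ltngtP (degree mu) (degree nu);
    by have := weight_degree h; rewrite hw ltnn.
case: mu nu hd hw => [[i j]|] [[i' j']|] //= [hd] /eqP.
rewrite hd eqn_mul2l /= /slope eqSS eqn_add2l => /eqP /val_inj hi; subst i'.
by rewrite (val_inj hd).
Qed.

Lemma character_weight (R : comNzRingType) (x : R) (mu : I) :
  character (fun i => x ^+ slope i) mu = x ^+ weight mu.
Proof. by case: mu => [p|] //=; rewrite -exprM mulnC. Qed.

End Weight.

(** * Reduced echelon form of a subspace with respect to the weight *)

Section Echelon.
Context (m : nat) (c : 'I_m -> nat) (k : fieldType).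
Local Notation I := (mono_idx c).
Local Notation weight := (@weight m c).

(** Leading means of lowest weight, since the limit is taken as [x] tends to 0. *)
Definition leading (B : set (Aplus c k)) : {set I} := finset (fun mu : I =>
  `[< exists f : Aplus c k, [/\ B f, f mu != 0 &
        forall nu, (weight nu < weight mu)%N -> f nu = 0] >]).

Definition triangular (S : {set I}) (b : I -> Aplus c k) : Prop :=
  forall mu nu, mu \in S -> (weight nu < weight mu)%N -> b mu nu = 0.

Lemma leadingP (B : set (Aplus c k)) mu : mu \in leading B <->
  exists f : Aplus c k, [/\ B f, f mu != 0 &
    forall nu, (weight nu < weight mu)%N -> f nu = 0].
Proof. by rewrite inE; split => /asboolP. Qed.

Context (B : set (Aplus c k)) (sB : subspace B).

(** The lightest monomial of a nonzero [f] in [B] would lie in [leading B], where [f] vanishes. *)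
Lemma leading_eq0 f : B f -> (forall mu, mu \in leading B -> f mu = 0) ->
  f = 0 :> Aplus c k.
Proof.
move=> Bf f0; apply: Aplus_ext => mu; rewrite [RHS]ffunE.
apply/eqP/contraT => fmu.
pose nu := [arg min_(nu < mu | f nu != 0%R) weight nu]%N.
have [fnu nu_min] : f nu != 0 /\
    forall ka, f ka != 0 -> (weight nu <= weight ka)%N.
  by rewrite /nu; case: arg_minnP.
suff /f0 hnu : nu \in leading B by rewrite hnu eqxx in fnu.
apply/leadingP; exists f; split=> // ka; rewrite ltnNge => hka.
by apply/eqP; apply: contraNT hka; apply: nu_min.
Qed.

(** An element with lowest term [mu] is scaled to coefficient 1 there, and its other coordinates in
    [leading B] are cleared by echelon elements of greater weight. The induction therefore runs from
    heavy monomials to light ones. *)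
Lemma echelon_elt mu : mu \in leading B -> exists f : Aplus c k,
  [/\ B f, forall nu, nu \in leading B -> f nu = (nu == mu)%:R &
      forall nu, (weight nu < weight mu)%N -> f nu = 0].
Proof.
pose W := (\max_nu weight nu).+1.
have hW nu : (weight nu < W)%N by rewrite ltnS; apply: leq_bigmax.
have [n] := ubnP (W - weight mu); elim: n mu => // n IH mu hn hmu.
have IH' : forall nu, exists f : Aplus c k, nu \in leading B ->
    (weight mu < weight nu)%N ->
  [/\ B f, forall ka, ka \in leading B -> f ka = (ka == nu)%:R &
      forall ka, (weight ka < weight nu)%N -> f ka = 0].
  move=> nu; case: (boolP (nu \in leading B)) => hnu; last by exists 0.
  case: (ltnP (weight mu) (weight nu)) => hmn; last by exists 0.
  have [|f hf] := IH nu _ hnu; last by exists f.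
  by rewrite -ltnS; apply: leq_trans hn; rewrite ltnS; apply: ltn_sub2l hmn.
have [b hb] := choice IH'.
have /leadingP[f0 [Bf0 f0mu f0low]] := hmu.
pose f : Aplus c k := (f0 mu)^-1 *: f0.
have fmu : f mu = 1 by rewrite Aplus_scaleE mulVf.
have flow nu : (weight nu < weight mu)%N -> f nu = 0.
  by move=> h; rewrite Aplus_scaleE (f0low _ h) mulr0.
pose P nu := (nu \in leading B) && (weight mu < weight nu)%N.
have hP nu : P nu -> [/\ B (b nu),
    forall ka, ka \in leading B -> b nu ka = (ka == nu)%:R &
    forall ka, (weight ka < weight nu)%N -> b nu ka = 0].
  by move=> /andP[]; apply: hb.
exists (f - \sum_(nu | P nu) f nu *: b nu); split.
- apply: subspaceB => //; first exact: subspaceZ.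
  by apply: subspace_sum => // nu /hP[].
- move=> nu hnu; rewrite ffunE [X in _ + X]ffunE sum_coefE.
  have [hlt|hlt|/weight_inj hE] := ltngtP (weight mu) (weight nu).
  + have Pnu : P nu by rewrite /P hnu.
    rewrite (bigD1 nu) //= big1 => [|ka /andP[/hP[_ hka _] hne]]; last first.
      by rewrite hka // eq_sym (negPf hne) mulr0.
    have [_ -> //] := hP _ Pnu; rewrite eqxx mulr1 addr0 subrr.
    by case: eqP hlt => // ->; rewrite ltnn.
  + rewrite flow // big1 ?subr0 => [|ka /andP[hka hlt']].
      by case: eqP hlt => // ->; rewrite ltnn.
    have [_ _ -> //] := hb ka hka hlt'; first by rewrite mulr0.
    exact: ltn_trans hlt hlt'.
  + subst nu; rewrite eqxx fmu big1 ?subr0 // => ka /andP[hka hlt'].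
    by have [_ _ -> //] := hb ka hka hlt'; rewrite mulr0.
- move=> nu hnu; rewrite ffunE [X in _ + X]ffunE sum_coefE flow //.
  rewrite big1 ?subr0 // => ka /andP[hka hlt'].
  have [_ _ -> //] := hb ka hka hlt'; first by rewrite mulr0.
  exact: ltn_trans hnu hlt'.
Qed.

Lemma echelon_form : exists b : I -> Aplus c k,
  [/\ reduced (leading B) b, triangular (leading B) b
    & B = span_graph (leading B) b].
Proof.
have h mu : exists f : Aplus c k, mu \in leading B ->
    [/\ B f, forall nu, nu \in leading B -> f nu = (nu == mu)%:R &
        forall nu, (weight nu < weight mu)%N -> f nu = 0].
  case: (boolP (mu \in leading B)) => hmu; last by exists 0.
  by have [f hf] := echelon_elt hmu; exists f.
have [b hb] := choice h; exists b.
have rb : reduced (leading B) b.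
  by move=> mu nu hmu hnu; have [_ ->] := hb _ hmu.
have Bb (u : I -> k) : B (\sum_(mu in leading B) u mu *: b mu).
  by apply: subspace_sum => // mu hmu; have [] := hb _ hmu.
split=> [//|mu nu hmu|]; first by have [_ _] := hb _ hmu; apply.
apply/seteqP; split=> [f Bf|f ->]; last exact: Bb.
rewrite /span_graph /mkset; apply/eqP; rewrite -subr_eq0; apply/eqP.
apply: leading_eq0; first exact: subspaceB.
move=> mu hmu; rewrite ffunE [X in _ + X]ffunE sum_coefE.
by rewrite (reduced_sum rb) // subrr.
Qed.

End Echelon.

(** * Products: monomial subalgebras, lowest terms, change of ring *)

Section Subalgebras.
Context (m : nat) (c : 'I_m -> nat).
Local Notation I := (mono_idx c).
Local Notation weight := (@weight m c).
Local Notation slope := (@slope m c).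

Lemma subalg_closedP (R : comNzRingType) (X : set (Aplus c R)) :
  GRing.subalg_closed (mem X) <->
  [/\ X 1, forall a x y, X x -> X y -> X (a *: x + y)
    & forall x y, X x -> X y -> X (x * y)].
Proof.
split=> [[X1 XD XM]|[X1 XD XM]].
  split; first by rewrite -in_setE.
    by move=> a x y hx hy; have := XD a x y; rewrite !in_setE; apply.
  by move=> x y hx hy; have := XM x y; rewrite !in_setE; apply.
split; first by rewrite in_setE.
  by move=> a x y; rewrite !in_setE; apply: XD.
by move=> x y; rewrite !in_setE; apply: XM.
Qed.

Lemma Ter_subspace (k : fieldType) g (X : set (Aplus c k)) :
  Ter g X -> subspace X.
Proof.
move=> [/subalg_closedP[X1 XD _] _]; split=> //.
by rewrite -(subrr 1) addrC -scaleN1r; apply: XD.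
Qed.

Lemma Ter_span_graph (k : fieldType) g S (b : I -> Aplus c k) :
  reduced S b -> Ter g (span_graph S b) -> #|~: S| = g.
Proof.
move=> rb hT; have sB := Ter_subspace hT; have [_ hg] := hT.
exact: (quot_dim_inj sB (locally_free_quot_dim sB
  (span_graph_locally_free rb)) (locally_free_quot_dim sB hg)).
Qed.

Lemma branch_coef_neq0 (R : comNzRingType) (f : Aplus c R) i n :
  (branch f i)`_n != 0 ->
  n = 0%N \/ exists2 j : 'I_(c i).-1, n = j.+1 & f (mono j) != 0.
Proof.
case: n => [|n]; [by left | move=> hf; right].
have [hn|hn] := ltnP n (c i).-1.
  by exists (Ordinal hn) => //; rewrite -branchS.
move: hf; rewrite coefD coefC add0r coef_sum big1 ?eqxx // => j _.
rewrite coefZ coefXn eqSS; case: eqP => [nj|_]; last by rewrite mulr0.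
by move: (ltn_ord j); rewrite -nj ltnNge hn.
Qed.

Lemma coef_mul0 (R : comNzRingType) (f g : Aplus c R) :
  (f * g) None = f None * g None.
Proof. by rewrite ffunE. Qed.

Lemma coef_mul_mono (R : comNzRingType) (f g : Aplus c R) i
    (j : 'I_(c i).-1) : (f * g) (mono j) =
  \sum_(a < j.+2) (branch f i)`_a * (branch g i)`_(j.+1 - a).
Proof. by rewrite ffunE /= coefM. Qed.

(** Distinct variables multiply to 0, so only products within one branch count, and those reaching
    [t_i ^ c i] vanish and impose nothing. The successors appear because [mono j] is
    [t_i ^ j.+1]. *)
Definition mono_closed (S : {set I}) : Prop :=
  (None \in S) /\ forall i (j j' l : 'I_(c i).-1), mono j \in S ->
    mono j' \in S -> (j.+1 + j'.+1)%N = l.+1 -> mono l \in S.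

Lemma span_graph_monomialP (R : comNzRingType) (S : {set I}) (f : Aplus c R) :
  span_graph S (monomial R) f <-> forall mu, mu \notin S -> f mu = 0.
Proof.
rewrite span_graphP; split=> h mu.
  move=> hmu; rewrite h big1 // => nu hnu; rewrite ffunE.
  by case: eqP hmu => [->|]; rewrite ?hnu ?mulr0.
case: (boolP (mu \in S)) => hmu.
  by rewrite (reduced_sum (reduced_monomial R (S := S))).
rewrite h // big1 // => nu hnu; rewrite ffunE.
by case: eqP hmu => [->|]; rewrite ?hnu ?mulr0.
Qed.

Lemma subalg_monomial (R : comNzRingType) (S : {set I}) : mono_closed S ->
  GRing.subalg_closed (mem (span_graph S (monomial R))).
Proof.
move=> [S0 SM]; apply/subalg_closedP; split=> [||f g].
- apply/span_graph_monomialP => mu hmu; rewrite ffunE.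
  by case: eqP hmu => [->|]; rewrite ?S0.
- exact: span_graph_linear.
move=> /span_graph_monomialP f0 /span_graph_monomialP g0.
apply/span_graph_monomialP => -[[i l]|]; last by rewrite S0.
move=> hl; rewrite -[Some _]/(mono l) coef_mul_mono big1 // => a _.
have [->|fa] := eqVneq ((branch f i)`_a) 0; first by rewrite mul0r.
have [->|ga] := eqVneq ((branch g i)`_(l.+1 - a)) 0; first by rewrite mulr0.
have suppS (h : Aplus c R) j : (forall mu, mu \notin S -> h mu = 0) ->
    h (@mono m c i j) != 0 -> mono j \in S.
  by move=> h0; apply: contraR => /h0 ->.
have eq_l (j : 'I_(c i).-1) : l.+1 = j.+1 -> mono j \notin S.
  by move=> [lj]; rewrite -(val_inj lj).
(* If one factor contributes its constant term, the other contributes [t_i ^ l.+1], which is not in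
   [S]; otherwise both contribute monomials in [S], whose product is in [S] too. *)
have [a0|[j aj fj]] := branch_coef_neq0 fa.
  move: ga; rewrite a0 subn0 => /branch_coef_neq0 [//|[j /eq_l hj gj]].
  by rewrite (suppS g) in hj.
have [al|[j' aj' gj']] := branch_coef_neq0 ga.
  have lj : l.+1 = j.+1 by rewrite -aj; have := ltn_ord a; lia.
  by have := eq_l _ lj; rewrite (suppS f).
rewrite (SM i j j' l (suppS f _ f0 fj) (suppS g _ g0 gj')) // in hl.
by rewrite -aj -aj' subnKC //; have := ltn_ord a; rewrite ltnS.
Qed.

Lemma Ter_monomial (R : comUnitRingType) (S : {set I}) : mono_closed S ->
  Ter #|~: S| (span_graph S (monomial R)).
Proof.
move=> hS; split; first exact: subalg_monomial.
apply: span_graph_locally_free; exact: reduced_monomial.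
Qed.

Lemma branch_low (R : comNzRingType) (f : Aplus c R) n i a :
  (forall nu, (weight nu < n)%N -> f nu = 0) ->
  (a * slope i < n)%N -> (branch f i)`_a = 0.
Proof.
move=> f0 ha; case: a ha => [|a] ha; first by rewrite branch0 f0.
have [//|/branch_coef_neq0[//|[j aj]]] := eqVneq ((branch f i)`_a.+1) 0.
by rewrite f0 ?eqxx //= -aj.
Qed.

(** Weights add along a branch, so the lowest terms of [f] and [g] multiply to the lowest term of
    [f * g]; its coefficient is nonzero because [k] is a field. *)
Lemma leading_closed (k : fieldType) (B : set (Aplus c k)) :
  GRing.subalg_closed (mem B) -> mono_closed (leading B).
Proof.
move=> /subalg_closedP[B1 _ BM]; split.
  by apply/leadingP; exists 1; split=> //; rewrite ffunE eqxx oner_neq0.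
move=> i j j' l /leadingP[f [Bf fj f0]] /leadingP[g [Bg gj g0]] hl.
(* When the total weight is below the sum of the two lowest weights, one of the factors is below its
   own lowest weight; this covers all branches, not only [i]. *)
have low i' a d : (a <= d)%N -> (d * slope i' < l.+1 * slope i)%N ->
    (branch f i')`_a * (branch g i')`_(d - a) = 0.
  move=> ad hd; have [ha|ha] := ltnP (a * slope i') (j.+1 * slope i).
    by rewrite (branch_low f0) ?mul0r.
  rewrite (branch_low (f := g) g0) ?mulr0 //=.
  move: ha hd; rewrite -hl mulnBl mulnDl; have := leq_mul ad (leqnn (slope i')).
  by lia.
apply/leadingP; exists (f * g); split; first exact: BM.
  have hj : (j.+1 < l.+2)%N by rewrite ltnS -hl leq_addr.
  rewrite coef_mul_mono (bigD1 (Ordinal hj)) //= big1 ?addr0.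
    by rewrite -hl addKn !branchS mulf_neq0.
  (* Any way to split the exponent [l.+1] other than [j.+1] plus [j'.+1] makes one of the factors
     too light. *)
  move=> a ha; have [haj|haj|haj] := ltngtP a j.+1.
  - by rewrite (branch_low f0) ?mul0r //= ltn_pmul2r.
  - rewrite (branch_low g0) ?mulr0 //= ltn_pmul2r //.
    by have := ltn_ord a; lia.
  - by case/eqP: ha; apply: val_inj.
move=> [[i' d]|] hnu; last by rewrite coef_mul0 f0 ?mul0r.
rewrite -[Some _]/(mono d) coef_mul_mono big1 // => a _.
by apply: low => //; rewrite -ltnS.
Qed.

Lemma span_graph_map (R R' : comUnitRingType) (phi : {rmorphism R -> R'}) S
    (b : I -> Aplus c R) f : span_graph S b f ->
  span_graph S (Aplus_map phi \o b) (Aplus_map phi f).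
Proof.
move=> /span_graphP hf; apply/span_graphP => nu; rewrite ffunE hf rmorph_sum.
by apply: eq_bigr => mu _; rewrite !ffunE rmorphM.
Qed.

Lemma span_graph_map_inj (R R' : comUnitRingType) (phi : {rmorphism R -> R'}) S
    (b : I -> Aplus c R) f : injective phi ->
  span_graph S (Aplus_map phi \o b) (Aplus_map phi f) -> span_graph S b f.
Proof.
move=> phiI /span_graphP hf; apply/span_graphP => nu; apply: phiI.
move: (hf nu); rewrite ffunE rmorph_sum => ->.
by apply: eq_bigr => mu _; rewrite !ffunE rmorphM.
Qed.

Lemma Aplus_map1 (R R' : comNzRingType) (phi : {rmorphism R -> R'}) :
  Aplus_map phi 1 = 1 :> Aplus c R'.
Proof. by have [] := Aplus_map_is_monoid_morphism c phi. Qed.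

Lemma Aplus_mapM (R R' : comNzRingType) (phi : {rmorphism R -> R'})
    (f g : Aplus c R) :
  Aplus_map phi (f * g) = Aplus_map phi f * Aplus_map phi g.
Proof. by have [_] := Aplus_map_is_monoid_morphism c phi; apply. Qed.

Lemma subalg_map (R R' : comUnitRingType) (phi : {rmorphism R -> R'}) S
    (b : I -> Aplus c R) : reduced S b ->
  GRing.subalg_closed (mem (span_graph S b)) ->
  GRing.subalg_closed (mem (span_graph S (Aplus_map phi \o b))).
Proof.
move=> rb /subalg_closedP[B1 _ BM]; apply/subalg_closedP; split.
- by rewrite -(Aplus_map1 phi); apply: span_graph_map.
- exact: span_graph_linear.
move=> f g hf hg; rewrite hf hg mulr_suml.
under eq_bigr => mu _ do rewrite -scalerAl.
apply: span_graph_lin_sum => mu hmu; rewrite mulr_sumr.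
under eq_bigr => nu _ do rewrite -scalerAr.
apply: span_graph_lin_sum => nu hnu; rewrite /= -Aplus_mapM.
by apply: span_graph_map; apply: BM; apply: span_graph_gen.
Qed.

(** Along an injection the equations of [span_graph] can be tested after applying [phi]. This serves
    to descend from [K(x)] to [K[x]]. *)
Lemma subalg_map_inj (R R' : comUnitRingType) (phi : {rmorphism R -> R'}) S
    (b : I -> Aplus c R) : injective phi ->
  GRing.subalg_closed (mem (span_graph S (Aplus_map phi \o b))) ->
  GRing.subalg_closed (mem (span_graph S b)).
Proof.
move=> phiI /subalg_closedP[B1 _ BM]; apply/subalg_closedP; split.
- by apply: span_graph_map_inj phiI _; rewrite Aplus_map1.
- exact: span_graph_linear.
move=> f g hf hg; apply: span_graph_map_inj phiI _; rewrite Aplus_mapM.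
by apply: BM; apply: span_graph_map.
Qed.

Lemma subalg_torus_act (R : comNzRingType) (lambda : 'I_m -> R)
    (X : set (Aplus c R)) : GRing.subalg_closed (mem X) ->
  GRing.subalg_closed (mem (torus_act lambda @` X)).
Proof.
have [T1 TM] := torus_act_is_monoid_morphism c lambda.
move=> /subalg_closedP[X1 XD XM]; apply/subalg_closedP; split.
- by exists 1.
- move=> a _ _ [f Xf <-] [g Xg <-]; exists (a *: f + g); first exact: XD.
  apply: Aplus_ext => nu.
  rewrite torus_actE [in LHS]ffunE Aplus_scaleE [RHS]ffunE Aplus_scaleE.
  by rewrite !torus_actE mulrDr mulrCA.
- by move=> _ _ [f Xf <-] [g Xg <-]; exists (f * g); [apply: XM | rewrite TM].
Qed.

End Subalgebras.

(** * The family over [K[x]] that degenerates to the span of lowest terms *)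

Section Degeneration.
Context (m : nat) (c : 'I_m -> nat) (K : fieldType).
Local Notation I := (mono_idx c).
Local Notation weight := (@weight m c).
Local Notation L := {fraction {poly K}}.

Definition to_poly : {rmorphism K -> {poly K}} := polyC.
Definition to_frac : {rmorphism {poly K} -> L} := @tofrac {poly K}.
Definition at_zero : {rmorphism {poly K} -> K} := horner_eval 0.

Definition to_ratfun : {rmorphism K -> L} := to_frac \o to_poly.

(** The torus element [x^w], as a point over [K(x)]. *)
Definition cochar (i : 'I_m) : L := to_frac 'X ^+ slope c i.

Lemma to_fracX_neq0 : to_frac 'X != 0.
Proof. by rewrite /to_frac /= tofrac_eq0 polyX_eq0. Qed.

Lemma torus_cochar : torus cochar.
Proof. by move=> i; rewrite unitfE expf_neq0 // to_fracX_neq0. Qed.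

Lemma to_frac_inj : injective to_frac.
Proof. by move=> p q /eqP; rewrite /to_frac /= tofrac_eq => /eqP. Qed.

Lemma to_fracXn_inj : injective (fun n => to_frac 'X ^+ n).
Proof.
move=> n n'; rewrite -!rmorphXn => /to_frac_inj.
move=> /(congr1 (fun p : {poly K} => size p)).
by rewrite !size_polyXn => -[].
Qed.

Lemma T_fixed_reduced S (b : I -> Aplus c K) : reduced S b ->
  T_fixed (span_graph S b) -> forall mu, mu \in S -> b mu = monomial K mu.
Proof.
move=> rb hT mu hmu; apply: Aplus_ext => nu; rewrite [RHS]ffunE.
have [->|nmu] := eqVneq nu mu; first by rewrite rb // eqxx.
have := hT _ to_ratfun _ torus_cochar; rewrite base_change_span_graph // => hE.
have : span_graph S (Aplus_map to_ratfun \o b)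
         (torus_act cochar (Aplus_map to_ratfun (b mu))).
  rewrite -hE; exists (Aplus_map to_ratfun (b mu)) => //.
  by apply: span_graph_map; apply: span_graph_gen.
(* As [b] is reduced, the translate of [b mu] has [mu] as its only coordinate in [S], so it is
   [x^(weight mu)] times [b mu]. At [nu] the factor is also [x^(weight nu)], and the two powers
   differ, so [b mu nu = 0]. *)
move=> /span_graphP/(_ nu); rewrite torus_actE (bigD1 mu) //= big1; last first.
  move=> ka /andP[hka /negPf hne].
  by rewrite torus_actE ffunE (rb _ _ hmu hka) hne rmorph0 mulr0 mul0r.
rewrite addr0 torus_actE !ffunE (rb _ _ hmu hmu) eqxx rmorph1 mulr1.
rewrite !character_weight => /eqP; rewrite -subr_eq0 -mulrBl mulf_eq0.
rewrite subr_eq0 fmorph_eq0 => /orP[/eqP/to_fracXn_inj/weight_inj hn|/eqP //].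
by rewrite hn eqxx in nmu.
Qed.

Context (S : {set I}) (b : I -> Aplus c K).
Context (rb : reduced S b) (tb : triangular S b).

(** This is [x^w . b mu] divided by [x^(weight mu)]. Truncated subtraction does no harm: for [mu] in
    [S], triangularity gives [b mu nu = 0] wherever [weight nu < weight mu]. *)
Definition degeneration (mu : I) : Aplus c {poly K} :=
  [ffun nu => (b mu nu)%:P * 'X^(weight nu - weight mu)].

Lemma reduced_degeneration : reduced S degeneration.
Proof.
move=> mu nu hmu hnu; rewrite ffunE rb //.
by case: eqP => [->|_]; rewrite ?subnn ?mul0r ?mulr1.
Qed.

Lemma degeneration_generic :
  torus_act cochar @` base_change to_ratfun (span_graph S b)
  = base_change to_frac (span_graph S degeneration).
Proof.
rewrite !base_change_span_graph //; last exact: reduced_degeneration.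
apply: torus_act_span_graph; first exact: torus_cochar.
move=> mu nu hmu; rewrite !character_weight !ffunE rmorphM rmorphXn mulrCA.
rewrite -exprD; have [h|h] := leqP (weight mu) (weight nu).
  by rewrite subnKC // mulrC.
by rewrite tb // !rmorph0 mulr0 mul0r.
Qed.

(** At [x = 0] only the exponent 0 survives; by triangularity and injectivity of the weight, this
    leaves just the coefficient 1 at [mu]. *)
Lemma degeneration_special : base_change at_zero (span_graph S degeneration)
  = span_graph S (monomial K).
Proof.
rewrite base_change_span_graph; last exact: reduced_degeneration.
have hb mu : mu \in S -> Aplus_map at_zero (degeneration mu) = monomial K mu.
  move=> hmu; apply: Aplus_ext => nu; rewrite !ffunE.
  rewrite /at_zero /= /horner_eval hornerM hornerC hornerXn expr0n.
  have [->|nmu] := eqVneq nu mu; first by rewrite subnn rb // eqxx mulr1.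
  have [h|h] := leqP (weight nu) (weight mu).
    rewrite tb ?mul0r // ltn_neqAle h andbT.
    by apply: contra nmu => /eqP/weight_inj ->.
  by rewrite subn_eq0 leqNgt h mulr0.
apply/seteqP; split=> f /span_graphP hf; apply/span_graphP => nu;
  by rewrite hf; apply: eq_bigr => mu hmu /=; rewrite hb.
Qed.

(** The echelon form makes the quotient free over [K[x]]. Closure under products holds over [K(x)],
    where the family is a torus translate of the given subalgebra, and descends because [K[x]]
    embeds in [K(x)]. *)
Lemma Ter_degeneration g : Ter g (span_graph S b) ->
  Ter g (span_graph S degeneration).
Proof.
move=> hT; split; last first.
  rewrite -(Ter_span_graph rb hT); apply: span_graph_locally_free.
  exact: reduced_degeneration.
apply: (subalg_map_inj to_frac_inj).
rewrite -base_change_span_graph; last exact: reduced_degeneration.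
rewrite -degeneration_generic base_change_span_graph //.
apply: subalg_torus_act; apply: subalg_map => //.
by case: hT.
Qed.

Lemma orbit_closure_degeneration (k : fieldType)
    (kappa : {rmorphism k -> K}) g :
  mono_closed S -> Ter g (span_graph S b) ->
  orbit_closure kappa g (span_graph S b) (span_graph S (monomial k)).
Proof.
move=> hS hT; have hg := Ter_span_graph rb hT.
have TerF : Ter g (span_graph S (monomial k)).
  by rewrite -hg; apply: Ter_monomial.
split=> // Z [_ Zcl] Zorb.
have [J hJ] := Zcl _ (to_poly \o kappa) _ (Ter_degeneration hT).
(* [J] cuts out [Z] along the [K[x]]-point given by the degeneration. Its fibre over [K(x)] is in
   the orbit, so these equations vanish in [K(x)], hence in [K[x]], and [Z] also contains the fibre
   at 0. *)
have J0 x : J x -> x = 0.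
  move=> Jx; apply: to_frac_inj; rewrite rmorph0; move: x Jx.
  apply/(hJ _ (to_ratfun \o kappa) to_frac) => //.
  rewrite -degeneration_generic; apply: Zorb => //; exact: torus_cochar.
have ZK : Z K kappa (span_graph S (monomial K)).
  rewrite -degeneration_special; apply/(hJ _ kappa at_zero).
    by move=> a; rewrite /= /horner_eval hornerC.
  by move=> x /J0 ->; rewrite rmorph0.
have bcF (R : comUnitRingType) (phi : {rmorphism k -> R}) :
    base_change phi (span_graph S (monomial k)) = span_graph S (monomial R).
  rewrite base_change_span_graph; last exact: reduced_monomial.
  congr span_graph; apply/funext => mu; apply: Aplus_ext => nu.
  by rewrite !ffunE rmorph_nat.
(* Descent from [K] to [k]: the equations of [Z] along the monomial [k]-point vanish in [K], hence
   in [k], as [kappa] is injective. *)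
have [J' hJ'] := Zcl _ idfun _ TerF.
have := hJ' _ kappa kappa (fun=> erefl); rewrite bcF => -[/(_ ZK) J'0 _].
rewrite -(bcF _ idfun); apply/(hJ' _ idfun idfun (fun=> erefl)) => x /J'0 /eqP.
by rewrite fmorph_eq0 => /eqP.
Qed.

End Degeneration.

(** * Powers of the ideal of the variables, and vanishing sequences *)

Section VanishingSequence.
Context (m : nat) (c : 'I_m -> nat).
Local Notation I := (mono_idx c).

Lemma branch_low_degree (R : comNzRingType) (f : Aplus c R) n i a :
  (forall nu, (degree nu < n)%N -> f nu = 0) ->
  (a < n)%N -> (branch f i)`_a = 0.
Proof.
move=> f0 ha; case: a ha => [|a] ha; first by rewrite branch0 f0.
have [//|/branch_coef_neq0[//|[j aj]]] := eqVneq ((branch f i)`_a.+1) 0.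
by rewrite f0 ?eqxx //= -aj.
Qed.

Lemma max_ideal_tvar (R : comNzRingType) i : max_ideal (tvar c R i).
Proof.
exists (fun i' => (i' == i)%:R); rewrite (bigD1 i) //= eqxx mul1r.
by rewrite big1 ?addr0 // => i' /negPf ->; rewrite mul0r.
Qed.

Lemma max_ideal_coef0 (R : comNzRingType) (f : Aplus c R) :
  max_ideal f -> f None = 0.
Proof.
by move=> [u ->]; rewrite sum_ffunE big1 // => i _; rewrite mulrC coef_tvarM0.
Qed.

Lemma max_ideal_pow_natP (R : comNzRingType) n (f : Aplus c R) :
  max_ideal_pow n%:Z f <-> forall mu, (degree mu < n)%N -> f mu = 0.
Proof.
elim: n f => [//|n IH] f; split.
  move=> [s [u [v [hu hv ->]]]] mu hmu; rewrite sum_ffunE big1 // => l _.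
  have u0 := max_ideal_coef0 (hu l); have /IH v0 := hv l.
  case: mu hmu => [[i j]|] hmu; last by rewrite coef_mul0 u0 mul0r.
  rewrite -[Some _]/(mono j) coef_mul_mono big1 // => -[[|a] ha] _ /=.
    by rewrite branch0 u0 mul0r.
  have hja : (j.+1 - a.+1 < n)%N by move: hmu => /=; lia.
  by rewrite (branch_low_degree i v0 hja) mulr0.
(* [v i] is the [i]-th branch of [f], stripped of its constant term and divided by [t_i]. The index
   [tagged p] stands for the exponent [(tagged p).+1], which comes from [(tagged p).+2] in [f]. *)
move=> f0; pose v i : Aplus c R := [ffun mu : I =>
  if mu is Some p then if tag p == i then (branch f i)`_(tagged p).+2 else 0
  else (branch f i)`_1].
exists m, (fun i => tvar c R i), v; split=> [i|i|].
- exact: max_ideal_tvar.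
- apply/IH => -[[i' j]|] hj; rewrite ffunE /=.
    by case: eqP => // _; apply: branch_low_degree f0 _.
  exact: branch_low_degree f0 _.
apply: AplusP => [|i j]; rewrite sum_ffunE.
  by rewrite f0 // big1 // => i _; rewrite coef_tvarM0.
rewrite (bigD1 i) //= big1 ?addr0 => [|i' hi]; last first.
  by rewrite coef_tvarM eq_sym (negPf hi).
rewrite coef_tvarM eqxx -branchS; case: j => -[|j] hj /=.
  by rewrite branch0 ffunE.
by rewrite -[j in RHS]/(val (Ordinal (ltnW hj))) branchS ffunE /= eqxx.
Qed.

Lemma max_ideal_powP (R : comNzRingType) (d : int) (f : Aplus c R) :
  max_ideal_pow d f <-> forall mu, ((degree mu)%:Z < d)%R -> f mu = 0.
Proof. by case: d => [n|n]; [exact: max_ideal_pow_natP | split]. Qed.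

Context (k : fieldType).

Lemma subspace_max_ideal_pow (X : set (Aplus c k)) d :
  subspace X -> subspace (X `&` max_ideal_pow d).
Proof.
move=> [X0 XD]; split.
  by split=> //; apply/max_ideal_powP => mu _; rewrite ffunE.
move=> a x y [Xx /max_ideal_powP x0] [Xy /max_ideal_powP y0].
split; first exact: XD.
apply/max_ideal_powP => mu hmu.
by rewrite ffunE Aplus_scaleE x0 // y0 // mulr0 addr0.
Qed.

Definition degree_part (S : {set I}) (d : int) : {set I} :=
  finset (fun mu => (mu \in S) && ((degree mu)%:Z == d)).

Context (S : {set I}) (b : I -> Aplus c k).
Context (rb : reduced S b) (tb : triangular S b).

Lemma triangular_degree mu nu : mu \in S ->
  (degree nu < degree mu)%N -> b mu nu = 0.
Proof. by move=> hmu h; apply: tb => //; apply: weight_degree. Qed.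

(** The [b mu] with [mu] of degree [d] are a basis of the graded piece: the weight refines the
    degree, so [b mu] has no terms of lower degree. *)
Lemma vanishing_sequence_span_graph :
  vanishing_sequence (span_graph S b) (fun d => #|degree_part S d|).
Proof.
move=> d; pose D := degree_part S d.
have DP mu : mu \in D -> mu \in S /\ (degree mu)%:Z = d.
  by rewrite inE => /andP[-> /eqP].
exists (fun j : 'I_#|D| => b (enum_val j)).
have sumE (u : I -> k) :
    \sum_(j < #|D|) u (enum_val j) *: b (enum_val j)
    = \sum_(mu in D) u mu *: b mu :> Aplus c k by rewrite [RHS]big_enum_val.
split=> [j|f [Bf /max_ideal_powP f0]|u].
- have [jS jd] := DP _ (enum_valP j); split; first exact: span_graph_gen.
  apply/max_ideal_powP => mu; rewrite -jd => h.
  exact: triangular_degree.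
- exists (fun j => f (enum_val j)); rewrite sumE.
  have sD : span_graph S b (\sum_(mu in D) f mu *: b mu).
    by apply: span_graph_sum => // mu /DP[].
  split.
    rewrite addrC -scaleN1r; exact: span_graph_linear.
  apply/max_ideal_powP => nu hnu.
  have {}hnu : ((degree nu)%:Z <= d)%R by lia.
  rewrite ffunE [X in _ + X]ffunE sum_coefE; move/span_graphP: Bf => ->.
  rewrite [X in X - _](bigID (fun mu => mu \in D)) /=.
  rewrite [X in X + _ - _](eq_bigl (fun mu => mu \in D)); last first.
    by move=> mu; rewrite inE andbA andbb.
  rewrite addrAC subrr add0r big1 // => mu /andP[hmu hD].
  (* A remaining [mu] of degree below [d] has [f mu = 0]; one of degree above [d] has [b mu] zero in
     all degrees up to [d]. *)
  have [h|h] := Order.TotalTheory.ltP (degree mu)%:Z d.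
    by rewrite f0 ?mul0r.
  rewrite triangular_degree ?mulr0 //.
  by move: hD; rewrite inE hmu /= => /eqP; lia.
have [v vE] := enum_val_extend 0 u.
under eq_bigr => j _ do rewrite -vE.
rewrite sumE => -[_ /max_ideal_powP h] j.
have [jS jd] := DP _ (enum_valP j).
have /h : ((degree (enum_val j))%:Z < d + 1)%R by lia.
rewrite sum_coefE (bigD1 (enum_val j)) ?enum_valP //= rb // eqxx mulr1.
rewrite big1 ?addr0 ?vE // => mu /andP[/DP[hmu _] /negPf hne].
by rewrite rb // eq_sym hne mulr0.
Qed.

Lemma vanishing_sequence_unique kd :
  vanishing_sequence (span_graph S b) kd -> forall d, kd d = #|degree_part S d|.
Proof.
move=> h d; apply: quot_dim_inj (h d) (vanishing_sequence_span_graph d).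
apply: subspace_max_ideal_pow; split; first exact: span_graph0.
exact: span_graph_linear.
Qed.

End VanishingSequence.

(** * Conductors, and the passage between monoids and sets of monomials *)

Lemma conductor_spec (M : set nat) a :
  numerical_monoid M -> M (conductor M + a)%N.
Proof.
move=> [_ _ /finite_fsetP[X hX]].
have hM n : (\max_(x <- X) x < n)%N -> M n.
  move=> hn; apply: contrapT => Mn.
  have : [set` X] n by rewrite -hX.
  move=> /= nX; have := leq_bigmax_seq (F := id) (P := xpredT) n nX isT.
  by rewrite leqNgt hn.
have hex : exists n, `[< forall a, M (n + a)%N >].
  exists (\max_(x <- X) x).+1; apply/asboolP => d; apply: hM.
  by rewrite addSn ltnS leq_addr.
case: (ex_minnP hex) => n /asboolP hn n_min.
(* A least such [n] exists, so [xget] does not return its default. *)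
have hP : exists n, (forall a, M (n + a)%N) /\
    forall n', (forall a, M (n' + a)%N) -> (n <= n')%N.
  by exists n; split=> // n' hn'; apply: n_min; apply/asboolP.
by have [] := xgetPex 0%N hP.
Qed.

Lemma conductor_min (M : set nat) n :
  (forall a, M (n + a)%N) -> (conductor M <= n)%N.
Proof. by rewrite /conductor; case: xgetP => // ? -> [_ h] /h. Qed.

Section Monoids.
Context (m : nat) (c : 'I_m -> nat) (hc : forall i, (0 < c i)%N).
Local Notation I := (mono_idx c).

(* Exponents outside 1, .., c i - 1 belong to the monoid vacuously. *)
Definition exponents (S : {set I}) (i : 'I_m) : set nat :=
  [set n | forall j : 'I_(c i).-1, n = j.+1 -> mono j \in S].

Definition support (M : 'I_m -> set nat) : {set I} := finset (fun mu : I =>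
  if mu is Some p then `[< M (tag p) (tagged p).+1 >] else true).

Lemma exponents_mono (S : {set I}) i (j : 'I_(c i).-1) :
  exponents S i j.+1 <-> mono j \in S.
Proof. by split=> [|hj j' [/val_inj <-]//]; apply. Qed.

Lemma exponents_large S i n : (c i <= n)%N -> exponents S i n.
Proof. by move=> hn j nj; have := ltn_ord j; have := hc i; lia. Qed.

Lemma card_branches (D : {set I}) : None \notin D ->
  #|D| = (\sum_i #|[pred j : 'I_(c i).-1 | mono j \in D]|)%N.
Proof.
move=> D0; rewrite -sum1_card.
rewrite (reindex_omap (Some : {i : 'I_m & 'I_(c i).-1} -> I) id); last first.
  by case=> [//|]; rewrite (negPf D0).
transitivity (\sum_i \sum_(j : 'I_(c i).-1 | mono j \in D) 1)%N.
  rewrite sig_big_dep /=; apply: eq_big => // -[i j] /=.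
  by rewrite eqxx andbT.
by apply: eq_bigr => i _; rewrite sum1_card.
Qed.

Lemma genus_exponents S i :
  genus (exponents S i) = #|[pred j : 'I_(c i).-1 | mono j \notin S]|.
Proof.
rewrite /genus.
have -> : ~` exponents S i = (fun j : 'I_(c i).-1 => j.+1) @`
    [set` [pred j : 'I_(c i).-1 | mono j \notin S]].
  apply/seteqP; split=> [n /existsNP[j /not_implyP[-> /negP hj]]|_ [j hj <-]].
    by exists j.
  by move=> /exponents_mono hj'; move: hj; rewrite /= inE hj'.
rewrite fset_set_image; last exact: finite_finpred.
rewrite card_imfset /=; last by move=> j j' [] /val_inj.
rewrite -(card_uniqP (fset_uniq _)); apply: eq_card => j.
by rewrite in_fset_set; [rewrite mem_setE | exact: finite_finpred].
Qed.

Lemma exponents_monoid S : mono_closed S ->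
  monoid_tuples c #|~: S| (exponents S).
Proof.
move=> [S0 SM]; split=> [i|i|].
- split=> [j //|a d ha hd l hl|].
    have /= ll := ltn_ord l.
    (* If a summand is 0 the sum is the other one; otherwise both are exponents of monomials in [S],
       and [mono_closed] applies. *)
    case: a ha hl => [|a] ha hl; first exact: hd.
    case: d hd hl => [|d] hd hl; first by apply: ha; rewrite -hl addn0.
    have la : (a < (c i).-1)%N by lia.
    have ld : (d < (c i).-1)%N by lia.
    apply: (SM i (Ordinal la) (Ordinal ld)) hl; [exact: ha | exact: hd].
  apply: (@sub_finite_set _ _ `I_(c i)); last exact: finite_II.
  move=> n /= hn; rewrite ltnNge; apply/negP => hcn; apply: hn.
  exact: exponents_large.
- by apply: conductor_min => a; apply: exponents_large; apply: leq_addr.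
rewrite card_branches; last by rewrite finset.in_setC S0.
apply: eq_bigr => i _.
rewrite genus_exponents; apply: eq_card => j.
by rewrite !inE.
Qed.

Lemma exponents_inj (S S' : {set I}) : None \in S -> None \in S' ->
  exponents S = exponents S' -> S = S'.
Proof.
move=> S0 S0' hE; apply/setP => -[[i j]|]; last by rewrite S0 S0'.
apply/idP/idP => /exponents_mono hj; apply/exponents_mono.
  by rewrite -hE.
by rewrite hE.
Qed.

Section Support.
Context (M : 'I_m -> set nat) (g : nat) (hM : monoid_tuples c g M).

Lemma support_closed : mono_closed (support M).
Proof.
have [nM _ _] := hM; split=> [|i j j' l]; first by rewrite inE.
rewrite !inE /= => /asboolP hj /asboolP hj' hl; apply/asboolP.
by rewrite -hl; have [_ + _] := nM i; apply.
Qed.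

(** From [c i] on, every exponent is in the left side vacuously and in [M i] because its conductor
    is at most [c i]; 0 is in both, and in between [support] records membership. *)
Lemma exponents_support : exponents (support M) = M.
Proof.
have [nM cM _] := hM; apply/funext => i; apply/seteqP; split=> n.
  have [hn|hn] := ltnP n (c i); last first.
    move=> _; rewrite -(subnKC (leq_trans (cM i) hn)).
    exact: conductor_spec.
  case: n hn => [|n] hn hS; first by have [] := nM i.
  have ln : (n < (c i).-1)%N by lia.
  by have := hS (Ordinal ln) erefl; rewrite inE => /asboolP.
by move=> Mn j nj; rewrite inE /=; apply/asboolP; rewrite -nj.
Qed.

Lemma card_support : #|~: support M| = g.
Proof.
have [_ _ <-] := exponents_monoid support_closed; rewrite exponents_support.
by have [] := hM.
Qed.

End Support.

(** Each branch has at most one monomial of degree [d], and has one exactly when [d < c i]. *)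
Lemma card_degree_part S d : (0 < d)%N ->
  #|degree_part S d%:Z| =
  #|[pred i : 'I_m | `[< exponents S i d >] && (d < c i)%N]|.
Proof.
move=> d0; rewrite card_branches; last first.
  by rewrite inE /= negb_and orbC; case: d d0.
rewrite -[RHS]sum1_card [RHS]big_mkcond; apply: eq_bigr => i _ /=.
case: d d0 => // d _; rewrite inE /=.
have [hd|hd] := ltnP d.+1 (c i); last first.
  rewrite andbF; apply: eq_card0 => j; rewrite !inE /= eqz_nat eqSS.
  by case: eqP => [jd|]; rewrite ?andbF //; have := ltn_ord j; lia.
have ld : (d < (c i).-1)%N by lia.
have hP : `[< exponents S i d.+1 >] = (mono (Ordinal ld) \in S).
  by apply/asboolP/idP => /(exponents_mono S (Ordinal ld)).
rewrite andbT hP; case: ifP => hS.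
  rewrite -(card1 (Ordinal ld)); apply: eq_card => j.
  rewrite !inE /= eqz_nat eqSS -(inj_eq val_inj) /= andbC.
  case: eqP => // jd; have <- : Ordinal ld = j by apply: val_inj.
  by rewrite hS.
apply: eq_card0 => j; rewrite !inE /= eqz_nat eqSS andbC.
case: eqP => // jd; have <- : Ordinal ld = j by apply: val_inj.
by rewrite hS.
Qed.

End Monoids.

(** * Fixed points as monomial spans, and the three claims *)

Lemma leading_monomial (m : nat) (c : 'I_m -> nat) (k : fieldType)
    (S : {set mono_idx c}) : leading (span_graph S (monomial k)) = S.
Proof.
apply/setP => mu; apply/idP/idP => [/leadingP[f []]|hmu].
  move=> /span_graph_monomialP f0 fmu _.
  by apply: contraR fmu => /f0 ->.
apply/leadingP; exists (monomial k mu); split.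
- exact: (span_graph_gen (reduced_monomial k (S := S))).
- by rewrite ffunE eqxx oner_neq0.
by move=> nu hnu; rewrite ffunE; case: eqP hnu => // ->; rewrite ltnn.
Qed.

Lemma T_fixed_TerE (m : nat) (c : 'I_m -> nat) (k : fieldType) g
    (B : set (Aplus c k)) : Ter g B -> T_fixed B ->
  B = span_graph (leading B) (monomial k).
Proof.
move=> hT hF; have [b [rb _ hB]] := echelon_form (Ter_subspace hT).
rewrite {1}hB; move: hF; rewrite {1}hB => hF.
have hb := T_fixed_reduced rb hF.
by apply/seteqP; split=> f /span_graphP hf; apply/span_graphP => nu;
  rewrite hf; apply: eq_bigr => mu hmu /=; rewrite hb.
Qed.

Lemma Ter_leading (m : nat) (c : 'I_m -> nat) (k : fieldType) g
    (B : set (Aplus c k)) : Ter g B ->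
  [/\ mono_closed (leading B), #|~: leading B| = g &
    exists b, [/\ reduced (leading B) b, triangular (leading B) b
      & B = span_graph (leading B) b]].
Proof.
move=> hT; have [b [rb tb hB]] := echelon_form (Ter_subspace hT).
have hC := leading_closed (proj1 hT).
split=> //; last by exists b.
by apply: (Ter_span_graph rb); rewrite -hB.
Qed.

Theorem theorem1p11 (k : fieldType) (m : nat) (c : 'I_m -> nat) (g : nat)
  (hc : forall i, (0 < c i)%N) :
  [/\ exists f : set (Aplus c k) -> ('I_m -> set nat),
        set_bij [set B | Ter g B /\ T_fixed B] (monoid_tuples c g) f,
      forall (K : fieldType) (kappa : {rmorphism k -> K}) (B : set (Aplus c K)),
        Ter g B ->
        exists F : set (Aplus c k), T_fixed F /\ orbit_closure kappa g B F
    & forall kd : int -> nat,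
        kd 0 = 1%N -> (forall d : int, d < 0 -> kd d = 0%N) ->
        (exists B : set (Aplus c k), stratum g kd B) <->
        (exists M : 'I_m -> set nat, monoid_tuples c g M /\
           forall d : nat, (1 <= d)%N ->
             kd d%:Z = #|[pred i : 'I_m | `[< M i d >] && (d < c i)%N]|)].
Proof.
split=> [|K kappa B hT|kd kd0 kdneg].
(* A fixed point is the span of [leading B], which gives injectivity; the preimage of [M] is the
   span of [support c M]. *)
- exists (fun B => exponents (leading B)); split=> [B [hT _]|B B'|M hM] /=.
  + by have [hS <- _] := Ter_leading hT; apply: exponents_monoid.
  + rewrite !in_setE => -[hT hF] [hT' hF'] hE.
    have [[S0 _] _ _] := Ter_leading hT; have [[S0' _] _ _] := Ter_leading hT'.
    rewrite (T_fixed_TerE hT hF) (T_fixed_TerE hT' hF').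
    by rewrite (exponents_inj S0 S0' hE).
  + exists (span_graph (support c M) (monomial k)).
      split; last exact: T_fixed_monomial.
      by rewrite -(card_support hc hM); apply/Ter_monomial/support_closed/hM.
    by rewrite leading_monomial (exponents_support hM).
- have [hS _ [b [rb tb hB]]] := Ter_leading hT.
  (* [B] lives over [K], but its lowest terms are monomials and span a subalgebra already over
     [k]. *)
  exists (span_graph (leading B) (monomial k)); split.
    exact: T_fixed_monomial.
  rewrite {1}hB; apply: orbit_closure_degeneration => //.
  by rewrite -hB.
split=> [[B [hT hV]]|[M [hM hkd]]].
  have [hS <- [b [rb tb hB]]] := Ter_leading hT.
  exists (exponents (leading B)); split; first exact: exponents_monoid.
  move=> d d0; rewrite -card_degree_part //.
  by apply: (vanishing_sequence_unique rb tb); rewrite -hB.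
have hS := support_closed hM.
exists (span_graph (support c M) (monomial k)); split.
  by rewrite -(card_support hc hM); apply: Ter_monomial.
have rb := reduced_monomial k (S := support c M).
have tb : triangular (support c M) (monomial k).
  by move=> mu nu _ h; rewrite ffunE; case: eqP h => // ->; rewrite ltnn.
suff -> : kd = fun d => #|degree_part (support c M) d|.
  exact: vanishing_sequence_span_graph.
(* The monoids prescribe [kd] in positive degrees; in degree 0 the monomial 1 alone counts, and no
   monomial has negative degree. *)
apply/funext => -[[|d]|d].
- rewrite kd0 -(card1 (None : mono_idx c)); apply: eq_card => -[p|].
    by rewrite !inE andbF.
  by rewrite !inE.
- by rewrite hkd // card_degree_part // (exponents_support hM).
- by rewrite kdneg //; apply/esym/eq_card0 => mu; rewrite !inE andbF.
Qed.
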